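(* For $d\in D:=\{4\cos^2(\pi/n)-1 : n=5,6,7,\dots\}\cup[3,\infty)$ let $\pi^{(d)}$ denote the Wysiwyg representation of Thompson's group $F$ with vacuum vector $\Psi$ (coming from the functor $\Phi^1$) built from the trivalent category with parameter $d$. If $d,d'\in D$ and $d\ne d'$, then the unitary representations $\pi^{(d)}$ and $\pi^{(d')}$ of $F$ are not unitarily equivalent.
   Context: **The trivalent category.** For $d\in D$, $\mathcal C$ is the following tensor category, with objects $1=X^{\otimes 0}$ and $X^{\otimes n}$ ($n\ge 1$). For $k\ge 0$, $\mathcal C_k$ is the complex vector space of linear combinations of planar diagrams (tangles) in a disc with $k$ boundary points numbered $1,\dots,k$ in cyclic order, consisting of strings, closed loops and an arbitrary number of trivalent vertices, up to planar isotopy, modulo the local skein relations: (1) a closed loop is the scalar $d$; (2) a diagram with a face bounded by a single edge attached to a vertex (a ''lollipop'') is $0$; (3) a bigon (two trivalent vertices joined by two parallel edges) equals a single string; (4) a triangle equals $\frac{d-2}{d-1}$ times a trivalent vertex; (5) for diagrams with two bottom and two top boundary points, $I-H=\frac1{d-1}\left(V-C\right)$, where $I$ has its two top points meeting at a vertex joined by a vertical edge to a vertex where the two bottom points meet, $H$ is two vertical strings joined by a horizontal edge, $V$ is two vertical strings, $C$ is a cup joining the top points together with a cap joining the bottom points; and finally modulo the kernel of the positive semidefinite Hermitian form $\langle x,y\rangle$ (linear in $x$) obtained by gluing $x$ to the mirror image of $y$ along the boundary and evaluating the closed diagram in $\mathcal C_0=\mathbb C$. One has $\dim\mathcal C_0=1$,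 $\dim\mathcal C_1=0$, $\dim\mathcal C_2=1$, $\dim\mathcal C_3=1$. $\mathrm{Mor}_{\mathcal C}(X^{\otimes a},X^{\otimes b})$ is $\mathcal C_{a+b}$ drawn in a rectangle with $a$ bottom and $b$ top points; composition is vertical stacking, $\otimes$ is horizontal juxtaposition, and $*$ is reflection in a horizontal line (conjugate linearly). $Y\in\mathrm{Mor}_{\mathcal C}(X,X\otimes X)$ is the single trivalent vertex; $Y^*Y=\mathrm{id}_X$. **Trees, forests and $F$.** $\mathfrak T$ is the set of finite planar rooted binary trees (including the tree with one leaf). A forest $f:m\to n$ is an $m$-tuple of such trees with $n$ leaves in total; forests compose by attaching roots to leaves, so if $s\in\mathfrak T$ has $m$ leaves then $fs\in\mathfrak T$ has $n$ leaves. Write $s\le t$ if $t=fs$ for some forest $f$; this makes $\mathfrak T$ a directed set. Elements of Thompson's group $F$ are classes $\frac st$ of pairs of trees with the same number of leaves, modulo $\frac st=\frac{fs}{ft}$, with product $\frac rs\frac st=\frac rt$; $\frac st$ is the piecewise linear homeomorphism of $[0,1]$ sending affinely the $i$-th standard dyadic interval defined by the leaves of $t$ onto the $i$-th one of $s$. **Direct limit and representation.** For a forest $f:m\to n$ let $\Phi(f)\in\mathrm{Mor}_{\mathcal C}(X^{\otimes m},X^{\otimes n})$ be $f$ read as a diagram with each branching vertex replaced by $Y$; it satisfies $\Phi(f)^*\Phi(f)=\mathrm{id}$. To a tree $t$ with $n$ leaves associate the Hilbert space $\Phi^1(n)=\mathrm{Mor}_{\mathcal C}(1,X^{\otimes n})=\mathcal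 C_n$ (zero for $n=1$), with inner product $\langle x,y\rangle=y^*x\in\mathcal C_0=\mathbb C$, and for $t=fs$ the isometric connecting map $x\mapsto\Phi(f)\circ x$. $\mathfrak H^1_Y$ is the Hilbert space completion of the direct limit; $\frac tx$ denotes the class of $(t,x)$. $F$ acts unitarily on $\mathfrak H^1_Y$ by $\pi\left(\frac st\right)\left(\frac tx\right)=\frac sx$. The vacuum vector $\Psi$ is the unit vector $\frac{t}{x}$ with $t$ the two-leaf tree and $x=d^{-1/2}$ times the string joining the two boundary points. The Wysiwyg representation with vacuum $\Psi$ is the restriction of $\pi$ to the closed linear span of $\{\pi(g)\Psi:g\in F\}$. *)

(* Defs.v *)
From HB Require Import structures.
From Stdlib Require Import Relation_Operators.
From mathcomp Require Import all_boot all_order all_algebra.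
From mathcomp Require Import all_classical all_reals all_analysis.
From mathcomp Require Import complex zify.
From mathcomp.multinomials Require Import freeg.

Set Implicit Arguments.
Unset Strict Implicit.
Unset Printing Implicit Defensive.

Import Order.TTheory GRing.Theory Num.Theory.

Local Open Scope classical_set_scope.
Local Open Scope ring_scope.
Local Open Scope complex_scope.

Definition span (K : nzRingType) (V : lmodType K) (S : set V) : set V :=
  [set v | exists (n : nat) (a : 'I_n -> K) (u : 'I_n -> V),
     (forall i, S (u i)) /\ v = \sum_(i < n) a i *: u i].

(* A planar diagram in a rectangle, in general position with respect to the
   height, is a word of elementary layers read from bottom to top.  The layer
   (i, g) has i vertical strings on the left of the elementary piece g, and as
   many strings as needed on its right.  [Fork] is the trivalent vertex with
   one leg down and two legs up (the morphism Y), [Merge] its reflection. *)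
Inductive piece := Cup | Cap | Fork | Merge.

HB.instance Definition _ := gen_eqMixin piece.
HB.instance Definition _ := gen_choiceMixin piece.

Definition legs_in (g : piece) : nat :=
  match g with Cup => 0 | Cap => 2 | Fork => 1 | Merge => 2 end.

Definition legs_out (g : piece) : nat :=
  match g with Cup => 2 | Cap => 0 | Fork => 2 | Merge => 1 end.

Definition reflect_piece (g : piece) : piece :=
  match g with Cup => Cap | Cap => Cup | Fork => Merge | Merge => Fork end.

Definition layer := (nat * piece)%type.

Definition word := seq layer.

(* [wf m w n]: w is a diagram with m bottom points and n top points. *)
Fixpoint wf (m : nat) (w : word) (n : nat) : bool :=
  match w with
  | [::] => m == n
  | (i, g) :: w' =>
      (i + legs_in g <= m)%N && wf (m - legs_in g + legs_out g)%N w' n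
  end.

Definition diagram (m n : nat) := {w : word | wf m w n}.

Lemma wf_cat m n p u v : wf m u n -> wf n v p -> wf m (u ++ v) p.
Proof.
elim: u m => [|[i g] u IH] m /=; first by move/eqP->.
by move=> /andP[-> H1] H2 /=; apply: IH.
Qed.

Definition mirror_word (w : word) : word :=
  rev [seq (l.1, reflect_piece l.2) | l <- w].

Lemma wf_mirror m w n : wf m w n -> wf n (mirror_word w) m.
Proof.
elim: w m => [|[i g] w IH] m /=; first by rewrite eq_sym.
move=> /andP[le_m H]; rewrite /mirror_word /= rev_cons -cats1.
apply: wf_cat (IH _ H) _; rewrite /= andbC.
move: le_m; case: g {H} => /= le_m; apply/andP; split; lia.
Qed.

Definition empty_diagram : diagram 0 0 := exist _ [::] isT.

Definition cup_diagram : diagram 0 2 := exist _ [:: (0%N, Cup)] isT.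

(* [stack v u] puts v on top of u. *)
Definition stack m n p (v : diagram n p) (u : diagram m n) : diagram m p :=
  exist _ (val u ++ val v) (wf_cat (valP u) (valP v)).

Definition mirror m n (u : diagram m n) : diagram n m :=
  exist _ (mirror_word (val u)) (wf_mirror (valP u)).

Section Skein.
Variable R : realType.
Implicit Types d : R.

(* Linear combinations of diagrams; Mor(X^m, X^n) is a quotient of it. *)
Definition Lin (m n : nat) := {freeg (diagram m n) / R[i]}.

Definition vec m n (D : diagram m n) : Lin m n := << D >>.

Definition lcomp m n p (y : Lin n p) (x : Lin m n) : Lin m p :=
  fglift (fun v : diagram n p =>
    fglift (fun u : diagram m n => vec (stack v u)) x) y.

Definition lstar m n (x : Lin m n) : Lin n m :=
  \sum_(D <- dom x) (coeff D x)^* *: vec (mirror D).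

(* A list [:: (a1, w1); ...; (ak, wk)] stands for a1 w1 + ... + ak wk = 0.
   The first five relations generate planar isotopy of diagrams in general
   position: exchange of the heights of distant pieces, straightening of
   zigzags, and turning a leg of a vertex from top to bottom on either side
   (hence rotation invariance of the vertex).  The others are the skein
   relations for a closed loop, a lollipop, a bigon, a triangle, and I - H. *)
Inductive local_relation d : seq (R[i] * word) -> Prop :=
| exchange i k g h : local_relation d
    [:: (1, [:: (i, g); ((i + legs_out g + k)%N, h)]);
        (-1, [:: ((i + legs_in g + k)%N, h); (i, g)])]
| zigzag_left i : local_relation d
    [:: (1, [:: (i.+1, Cup); (i, Cap)]); (-1, [::])]
| zigzag_right i : local_relation d
    [:: (1, [:: (i, Cup); (i.+1, Cap)]); (-1, [::])]
| turn_left i : local_relation d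
    [:: (1, [:: (i.+1, Fork); (i, Cap)]); (-1, [:: (i, Merge)])]
| turn_right i : local_relation d
    [:: (1, [:: (i, Fork); (i.+1, Cap)]); (-1, [:: (i, Merge)])]
| loop i : local_relation d
    [:: (1, [:: (i, Cup); (i, Cap)]); (- d%:C, [::])]
| lollipop i : local_relation d
    [:: (1, [:: (i, Fork); (i, Cap)])]
| bigon i : local_relation d
    [:: (1, [:: (i, Fork); (i, Merge)]); (-1, [::])]
| triangle i : local_relation d
    [:: (1, [:: (i, Fork); (i, Fork); (i.+1, Merge)]);
        (- ((d - 2) / (d - 1))%:C, [:: (i, Fork)])]
| I_minus_H i : local_relation d
    [:: (1, [:: (i, Merge); (i, Fork)]);
        (-1, [:: (i, Fork); (i.+1, Merge)]);
        (- ((d - 1)^-1)%:C, [::]);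
        (((d - 1)^-1)%:C, [:: (i, Cap); (i, Cup)])].

(* The linear combination, as a vector; terms that are not diagrams from m to
   n would be dropped, but [skein_relator] excludes them. *)
Definition lin_of_seq m n (r : seq (R[i] * word)) : Lin m n :=
  \sum_(p <- r) p.1 *: oapp (@vec m n) 0 (insub p.2).

(* The local relations, applied inside an arbitrary diagram from m to n. *)
Definition skein_relator d m n : set (Lin m n) :=
  [set x | exists (u v : word) (r : seq (R[i] * word)),
     [/\ local_relation d r,
         all (fun p => wf m (u ++ p.2 ++ v) n) r &
         x = lin_of_seq m n [seq (p.1, u ++ p.2 ++ v) | p <- r]]].

Definition skein_eq d m n (x y : Lin m n) : Prop :=
  span (@skein_relator d m n) (x - y).

(* The scalar c such that the closed diagram x is c times the empty one. *)
Definition ev d (x : Lin 0 0) : R[i] :=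
  xget 0 [set c : R[i] | skein_eq d x (c *: vec empty_diagram)].

(* The Hermitian form on diagrams with n boundary points: C_n is the quotient
   of [Lin 0 n] by its kernel, with inner product y^* x. *)
Definition gram d n (x y : Lin 0 n) : R[i] := ev d (lcomp (lstar y) x).

End Skein.

Inductive tree := Leaf | Node of tree & tree.

HB.instance Definition _ := gen_eqMixin tree.
HB.instance Definition _ := gen_choiceMixin tree.

Fixpoint leaves (t : tree) : nat :=
  if t is Node l r then (leaves l + leaves r)%N else 1%N.

Definition is_forest (m n : nat) (f : seq tree) : bool :=
  (size f == m) && (sumn (map leaves f) == n).

Definition ntree (n : nat) := {t : tree | leaves t == n}.
Definition forest (m n : nat) := {f : seq tree | is_forest m n f}.

Fixpoint attach (f : seq tree) (t : tree) : tree :=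
  if t is Node l r
  then Node (attach (take (leaves l) f) l) (attach (drop (leaves l) f) r)
  else head Leaf f.

Lemma leaves_attach f t :
  size f = leaves t -> leaves (attach f t) = sumn (map leaves f).
Proof.
elim: t f => [|l IHl r IHr] f /=.
  by case: f => [|a [|b f]] //= _; rewrite addn0.
move=> sf; rewrite IHl ?IHr ?size_drop ?size_takel ?sf ?addKn ?leq_addr //.
by rewrite -sumn_cat -map_cat cat_take_drop.
Qed.

Lemma leaves_graft m n (f : forest m n) (t : ntree m) :
  leaves (attach (val f) (val t)) == n.
Proof.
case: f t => f /= /andP[/eqP sf /eqP ff] [t /= /eqP lt].
by rewrite leaves_attach ?ff // sf lt.
Qed.

Definition graft m n (f : forest m n) (t : ntree m) : ntree n :=
  exist _ (attach (val f) (val t)) (leaves_graft f t).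

(* The diagram of a tree whose root is the string number i (from 0). *)
Fixpoint tree_word (i : nat) (t : tree) : word :=
  if t is Node l r
  then (i, Fork) :: tree_word i l ++ tree_word (i + leaves l) r
  else [::].

Fixpoint forest_word (i : nat) (f : seq tree) : word :=
  if f is t :: f' then tree_word i t ++ forest_word (i + leaves t) f' else [::].

Lemma wf_tree_word i t k :
  wf (i + 1 + k) (tree_word i t) (i + leaves t + k).
Proof.
elim: t i k => [|l IHl r IHr] i k //=.
apply/andP; split; first by rewrite leq_addr.
have -> : (i + 1 + k - 1 + 2 = i + 1 + k.+1)%N by lia.
apply: wf_cat (IHl _ _) _.
have -> : (i + leaves l + k.+1 = i + leaves l + 1 + k)%N by lia.
by rewrite addnA; exact: IHr.
Qed.

Lemma wf_forest_word i f :
  wf (i + size f) (forest_word i f) (i + sumn (map leaves f)).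
Proof.
elim: f i => [|t f IH] i //=.
have -> : (i + (size f).+1 = i + 1 + size f)%N by lia.
by apply: wf_cat (wf_tree_word _ _ _) _; rewrite addnA; exact: IH.
Qed.

Lemma wf_forest m n (f : forest m n) : wf m (forest_word 0 (val f)) n.
Proof.
case: f => f /= /andP[/eqP <- /eqP <-]; exact: (wf_forest_word 0 f).
Qed.

Definition Phi m n (f : forest m n) : diagram m n :=
  exist _ (forest_word 0 (val f)) (wf_forest f).

Definition caret : ntree 2 := exist _ (Node Leaf Leaf) isT.

Definition tree_pair := {p : tree * tree | leaves p.1 == leaves p.2}.

(* (s, t) becomes (fs, ft) for some forest f. *)
Definition expands (p q : tree_pair) : Prop :=
  exists f : seq tree, [/\ size f = leaves (val p).1,
    (val q).1 = attach f (val p).1 & (val q).2 = attach f (val p).2].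

Definition tree_pair_equiv (p q : tree_pair) : bool :=
  `[< clos_refl_sym_trans tree_pair expands p q >].

Lemma tree_pair_equiv_refl : reflexive tree_pair_equiv.
Proof. by move=> p; apply/asboolP; exact: rst_refl. Qed.

Lemma tree_pair_equiv_sym : symmetric tree_pair_equiv.
Proof. by move=> p q; apply/asboolP/asboolP; exact: rst_sym. Qed.

Lemma tree_pair_equiv_trans : transitive tree_pair_equiv.
Proof.
by move=> q p r /asboolP pq /asboolP qr; apply/asboolP; exact: rst_trans pq qr.
Qed.

Canonical tree_pair_equiv_rel := EquivRel tree_pair_equiv
  tree_pair_equiv_refl tree_pair_equiv_sym tree_pair_equiv_trans.

Local Open Scope quotient_scope.

Definition thompsonF := {eq_quot tree_pair_equiv_rel}.
HB.instance Definition _ := Choice.on thompsonF.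
HB.instance Definition _ := EqQuotient.on thompsonF.

Definition pair_frac (s t : tree) (st : leaves s == leaves t) : thompsonF :=
  \pi_thompsonF (exist (fun p : tree * tree => leaves p.1 == leaves p.2) (s, t) st).

Lemma leaves_pair n (s t : ntree n) : leaves (val s) == leaves (val t).
Proof. by rewrite (eqP (valP s)) (eqP (valP t)). Qed.

Definition frac n (s t : ntree n) : thompsonF := pair_frac (leaves_pair s t).

(* The smallest common expansion of two trees. *)
Fixpoint join (s t : tree) : tree :=
  match s, t with
  | Leaf, _ => t
  | _, Leaf => s
  | Node l r, Node l' r' => Node (join l l') (join r r')
  end.

(* The forest f with attach f s = t, when there is one. *)
Fixpoint residue (s t : tree) : seq tree :=
  match s, t with
  | Leaf, _ => [:: t]
  | Node l r, Node l' r' => residue l l' ++ residue r r'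
  | _, Leaf => nseq (leaves s) Leaf
  end.

Lemma size_residue s t : size (residue s t) = leaves s.
Proof.
elim: s t => [|l IHl r IHr] [|l' r'] //=; first by rewrite size_nseq.
by rewrite size_cat IHl IHr.
Qed.

Lemma attach_nseq n t : n = leaves t -> attach (nseq n Leaf) t = t.
Proof.
move->; elim: t => [|l IHl r IHr] //=.
by rewrite take_nseq ?leq_addr // drop_nseq addKn IHl IHr.
Qed.

Lemma attach_residue s : attach (residue s s) s = s.
Proof.
elim: s => [|l IHl r IHr] //=.
by rewrite take_size_cat ?drop_size_cat ?size_residue // IHl IHr.
Qed.

Lemma attach_residueL s t : attach (residue s (join s t)) s = join s t.
Proof.
elim: s t => [|l IHl r IHr] [|l' r'] //; first exact: attach_residue.
by rewrite /= take_size_cat ?drop_size_cat ?size_residue // IHl IHr.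
Qed.

Lemma joinC : commutative join.
Proof. by elim=> [|l IHl r IHr] [|l' r'] //=; rewrite IHl IHr. Qed.

Lemma attach_residueR s t : attach (residue t (join s t)) t = join s t.
Proof. by rewrite joinC attach_residueL. Qed.

Fixpoint forest_comp (g f : seq tree) : seq tree :=
  if f is t :: f'
  then attach (take (leaves t) g) t :: forest_comp (drop (leaves t) g) f'
  else [::].

Lemma size_forest_comp g f : size (forest_comp g f) = size f.
Proof. by elim: f g => //= t f IH g; rewrite IH. Qed.

Lemma forest_comp_take g f k :
  take k (forest_comp g f) = forest_comp (take (sumn (map leaves (take k f))) g) (take k f).
Proof.
elim: f g k => [|t f IH] g [|k] //=; rewrite IH take_takel ?leq_addr //.
by congr (_ :: forest_comp _ _); rewrite take_drop addnC.
Qed.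

Lemma forest_comp_drop g f k :
  drop k (forest_comp g f) = forest_comp (drop (sumn (map leaves (take k f))) g) (drop k f).
Proof.
elim: f g k => [|t f IH] g [|k] //=; first by rewrite drop0.
by rewrite IH drop_drop addnC.
Qed.

Lemma attach_take g t k : (leaves t <= k)%N -> attach (take k g) t = attach g t.
Proof.
elim: t g k => [|l IHl r IHr] g k /=; first by case: g k => [|a g] [|k].
move=> le_k; rewrite take_takel; last by lia.
have -> : k = (k - leaves l + leaves l)%N by lia.
by rewrite -take_drop IHr //; lia.
Qed.

Lemma attach_attach g f t : size f = leaves t ->
  attach g (attach f t) = attach (forest_comp g f) t.
Proof.
elim: t f g => [|l IHl r IHr] f g /=.
  by case: f => [|a f] //= _; rewrite attach_take.
move=> sf; rewrite forest_comp_take forest_comp_drop.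
have sl : size (take (leaves l) f) = leaves l by rewrite size_takel // sf leq_addr.
have sr : size (drop (leaves l) f) = leaves r by rewrite size_drop sf addKn.
by rewrite -IHl // -IHr // leaves_attach.
Qed.

Lemma attach_inj f g t : size f = leaves t -> size g = leaves t ->
  attach f t = attach g t -> f = g.
Proof.
elim: t f g => [|l IHl r IHr] f g /=.
  by case: f g => [|a [|? ?]] [|b [|? ?]] //= _ _ ->.
move=> sf sg [el er]; rewrite -(cat_take_drop (leaves l) f) -(cat_take_drop (leaves l) g).
by congr (_ ++ _); [apply: IHl el|apply: IHr er];
  rewrite ?size_takel ?size_drop ?sf ?sg ?addKn ?leq_addr.
Qed.

(* [mul_spec p q z]: expanding p = r/s and q = s'/t so that the denominator
   of p becomes the numerator of q, the outer trees form z. *)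
Definition mul_spec (p q z : tree_pair) : Prop :=
  exists f g : seq tree,
    [/\ size f = leaves (val p).1, size g = leaves (val q).1,
        attach f (val p).2 = attach g (val q).1 &
        val z = (attach f (val p).1, attach g (val q).2)].

Lemma mul_pair_subproof (p q : tree_pair) :
  let J := join (val p).2 (val q).1 in
  leaves (attach (residue (val p).2 J) (val p).1)
    == leaves (attach (residue (val q).1 J) (val q).2).
Proof.
case: p q => [[a b] /= /eqP ab] [[c e] /= /eqP ce].
rewrite leaves_attach ?size_residue // -(@leaves_attach _ b) ?size_residue //.
rewrite (@leaves_attach _ e) ?size_residue // -(@leaves_attach _ c) ?size_residue //.
by rewrite attach_residueL attach_residueR.
Qed.

Definition mul_pair (p q : tree_pair) : tree_pair :=
  exist _ (_, _) (mul_pair_subproof p q).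

Lemma mul_pairP p q : mul_spec p q (mul_pair p q).
Proof.
set J := join (val p).2 (val q).1.
exists (residue (val p).2 J), (residue (val q).1 J); split => //.
- by rewrite size_residue (eqP (valP p)).
- by rewrite size_residue.
- by rewrite attach_residueL attach_residueR.
Qed.

Lemma expands_equiv p q : expands p q -> tree_pair_equiv p q.
Proof. by move=> pq; apply/asboolP; exact: rst_step. Qed.

Lemma expand_ex (p : tree_pair) f : size f = leaves (val p).1 ->
  exists2 q, expands p q & val q = (attach f (val p).1, attach f (val p).2).
Proof.
case: p => -[a b] ab /= sf.
have ab' : leaves (attach f a) == leaves (attach f b).
  by rewrite !leaves_attach // sf (eqP ab).
exists (exist (fun p : tree * tree => leaves p.1 == leaves p.2) (_, _) ab') => //.
by exists f; split.
Qed.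

Lemma mul_spec_fun p q z z' :
  mul_spec p q z -> mul_spec p q z' -> tree_pair_equiv z z'.
Proof.
move=> [f [g [sf sg fg ez]]] [f' [g' [sf' sg' fg' ez']]].
set J := attach f (val p).2; set J' := attach f' (val p).2.
set h := residue J (join J J'); set h' := residue J' (join J J').
have sp := eqP (valP p); have sq := eqP (valP q).
have hJ : attach h J = attach h' J' by rewrite attach_residueL attach_residueR.
have eF : forest_comp h f = forest_comp h' f'.
  apply: (@attach_inj _ _ (val p).2); rewrite ?size_forest_comp -?sp //.
  by rewrite -!attach_attach // -?sp.
have eG : forest_comp h g = forest_comp h' g'.
  apply: (@attach_inj _ _ (val q).1); rewrite ?size_forest_comp //.
  by rewrite -!attach_attach // -fg -fg'.
have lz : size h = leaves (val z).1.
  by rewrite ez /= size_residue /J !leaves_attach // sf sp.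
have lz' : size h' = leaves (val z').1.
  by rewrite ez' /= size_residue /J' !leaves_attach // sf' sp.
have [w zw ew] := expand_ex lz; have [w' zw' ew'] := expand_ex lz'.
have eww : w = w'.
  apply: val_inj; rewrite ew ew' ez ez' /= !attach_attach ?eF ?eG //; last 2 first.
  - by rewrite sg' sq.
  - by rewrite sg sq.
apply: tree_pair_equiv_trans (expands_equiv zw) _.
by rewrite eww tree_pair_equiv_sym; exact: expands_equiv.
Qed.

Lemma mul_spec_expandl p p' q z : expands p p' -> mul_spec p' q z -> mul_spec p q z.
Proof.
move=> [h [sh e1 e2]] [f [g [sf sg fg ez]]].
have sp := eqP (valP p).
exists (forest_comp f h), g; split; rewrite ?size_forest_comp //.
  by rewrite -attach_attach -?sp // -e2.
by rewrite ez e1 attach_attach.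
Qed.

Lemma mul_spec_expandr p q q' z : expands q q' -> mul_spec p q' z -> mul_spec p q z.
Proof.
move=> [h [sh e1 e2]] [f [g [sf sg fg ez]]].
have sq := eqP (valP q).
exists f, (forest_comp g h); split; rewrite ?size_forest_comp //.
  by rewrite -attach_attach // -e1.
by rewrite ez e2 attach_attach -?sq.
Qed.

Lemma mul_spec_congr p p' q q' z z' :
  tree_pair_equiv p p' -> tree_pair_equiv q q' ->
  mul_spec p q z -> mul_spec p' q' z' -> tree_pair_equiv z z'.
Proof.
move=> /asboolP pp' /asboolP qq' pqz pqz'.
have [w pqw] : exists w, mul_spec p' q w by exists (mul_pair p' q); exact: mul_pairP.
have zw : tree_pair_equiv z w.
  elim: pp' z w pqz pqw {pqz' z' qq' q'} => [x y xy|x|x y _ IH|x y t _ IH1 _ IH2] z w zx wy.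
  - by apply: mul_spec_fun zx _; exact: mul_spec_expandl xy wy.
  - exact: mul_spec_fun zx wy.
  - by rewrite tree_pair_equiv_sym; exact: IH wy zx.
  - by apply: tree_pair_equiv_trans (IH1 _ _ zx (mul_pairP _ _)) _; apply: IH2 wy; exact: mul_pairP.
apply: tree_pair_equiv_trans zw _.
elim: qq' w z' pqw pqz' {pqz z pp' p} => [x y xy|x|x y _ IH|x y t _ IH1 _ IH2] z w zx wy.
- by apply: mul_spec_fun zx _; exact: mul_spec_expandr xy wy.
- exact: mul_spec_fun zx wy.
- by rewrite tree_pair_equiv_sym; exact: IH wy zx.
- by apply: tree_pair_equiv_trans (IH1 _ _ zx (mul_pairP _ _)) _; apply: IH2 wy; exact: mul_pairP.
Qed.

Definition mulF (x y : thompsonF) : thompsonF :=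
  \pi_thompsonF (mul_pair (repr x) (repr y)).

Definition oneF : thompsonF := @pair_frac Leaf Leaf isT.

Definition inv_pair (p : tree_pair) : tree_pair :=
  exist (fun p : tree * tree => leaves p.1 == leaves p.2)
    ((val p).2, (val p).1) (etrans (eq_sym _ _) (valP p)).

Definition invF (x : thompsonF) : thompsonF := \pi_thompsonF (inv_pair (repr x)).

Lemma pair_frac_eq s t s' t' st st' :
  s = s' -> t = t' -> @pair_frac s t st = @pair_frac s' t' st'.
Proof. by move=> es et; subst s' t'; rewrite (eq_irrelevance st st'). Qed.

Lemma pair_frac_attach f s t st st' : size f = leaves s ->
  @pair_frac (attach f s) (attach f t) st' = @pair_frac s t st.
Proof.
move=> sf; apply/eqquotP; rewrite /= tree_pair_equiv_sym.
by apply: expands_equiv; exists f.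
Qed.

Lemma mulF_frac r s t rs st rt :
  mulF (@pair_frac r s rs) (@pair_frac s t st) = @pair_frac r t rt.
Proof.
apply/eqquotP => /=; apply: mul_spec_congr (mul_pairP _ _) _.
- exact/eqquotP/reprK.
- exact/eqquotP/reprK.
- exists (nseq (leaves r) Leaf), (nseq (leaves s) Leaf).
  by split; rewrite /= ?size_nseq // !attach_nseq // ?(eqP rs) ?(eqP st).
Qed.

Lemma pair_fracW (P : thompsonF -> Prop) :
  (forall s t st, P (@pair_frac s t st)) -> forall x, P x.
Proof. by move=> H; apply: quotW => -[[s t] st]; exact: H. Qed.

(* Two fractions can be written r/s and s/t. *)
Lemma pair_fracW2 a b c e (ab : leaves a == leaves b) (ce : leaves c == leaves e) :
  exists f g, [/\ size f = leaves a, size g = leaves c & attach f b = attach g c].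
Proof.
exists (residue b (join b c)), (residue c (join b c)).
by rewrite !size_residue attach_residueL attach_residueR (eqP ab).
Qed.

Lemma leaves_attach_pair f a b :
  leaves a == leaves b -> size f = leaves a -> leaves (attach f a) == leaves (attach f b).
Proof. by move=> ab sf; rewrite !leaves_attach // sf (eqP ab). Qed.

Lemma mulFA : associative mulF.
Proof.
move=> x y z; move: x; apply: pair_fracW => a b ab; move: y; apply: pair_fracW => c e ce.
move: z; apply: pair_fracW => u v uv.
have [f [g [sf sg fg]]] := pair_fracW2 ab ce.
have ab1 := leaves_attach_pair ab sf; have ce1 := leaves_attach_pair ce sg.
rewrite -(pair_frac_attach ab ab1 sf) -(pair_frac_attach ce ce1 sg).
move: {f g sf sg ab ce} (attach f a) (attach f b) (attach g c) (attach g e) fg ab1 ce1.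
move=> {}a {}b {}c {}e bc ab ce; subst c.
have [f [g [sf sg fg]]] := pair_fracW2 ce uv.
have sfa : size f = leaves a by rewrite sf (eqP ab).
have ab1 := leaves_attach_pair ab sfa; have ce1 := leaves_attach_pair ce sf.
have uv1 := leaves_attach_pair uv sg.
rewrite -(pair_frac_attach ab ab1 sfa) -(pair_frac_attach ce ce1 sf).
rewrite -(pair_frac_attach uv uv1 sg).
move: uv1; rewrite -fg => uv1.
have ae := etrans (etrans (f_equal (eq_op^~ _) (eqP ab1)) ce1) erefl.
have bv := etrans (etrans (f_equal (eq_op^~ _) (eqP ce1)) uv1) erefl.
have av := etrans (etrans (f_equal (eq_op^~ _) (eqP ab1)) bv) erefl.
by rewrite (mulF_frac _ _ bv) (mulF_frac _ _ ae) (mulF_frac _ _ av) (mulF_frac _ _ av).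
Qed.

Lemma oneF_frac s (ss : leaves s == leaves s) : oneF = pair_frac ss.
Proof. by rewrite /oneF -(@pair_frac_attach [:: s] Leaf Leaf isT ss). Qed.

Lemma mul1F : left_id oneF mulF.
Proof. move=> x; move: x; apply: pair_fracW => s t st; rewrite (oneF_frac (eqxx (leaves s))); exact: mulF_frac. Qed.

Lemma mulF1 : right_id oneF mulF.
Proof. move=> x; move: x; apply: pair_fracW => s t st; rewrite (oneF_frac (eqxx (leaves t))); exact: mulF_frac. Qed.

Lemma invF_repr x : exists s t st ts, x = @pair_frac s t st /\ invF x = @pair_frac t s ts.
Proof.
have := reprK x; rewrite /invF; case: (repr x) => -[s t] st ex.
exists s, t, st, (etrans (eq_sym _ _) st); split; first by rewrite -ex.
by rewrite /pair_frac; congr (\pi_thompsonF _); exact: val_inj.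
Qed.

Lemma mulVF : left_inverse oneF invF mulF.
Proof.
move=> x; have [s [t [st [ts [-> ->]]]]] := invF_repr x.
by rewrite (oneF_frac (eqxx (leaves t))) (mulF_frac _ _ (eqxx _)).
Qed.

Lemma mulFV : right_inverse oneF invF mulF.
Proof.
move=> x; have [s [t [st [ts [-> ->]]]]] := invF_repr x.
by rewrite (oneF_frac (eqxx (leaves s))) (mulF_frac _ _ (eqxx _)).
Qed.

HB.instance Definition _ := isGroup.Build thompsonF mulFA mul1F mulF1 mulVF mulFV.

(* The defining product of F, and the equality of s/t with fs/ft. *)
Lemma frac_mul n (r s t : ntree n) : (frac r s * frac s t)%g = frac r t.
Proof. exact: mulF_frac. Qed.

Lemma frac_graft m n (f : forest m n) (s t : ntree m) :
  frac (graft f s) (graft f t) = frac s t.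
Proof.
apply: pair_frac_attach.
by case/andP: (valP f) => /eqP -> _; rewrite (eqP (valP s)).
Qed.

Section Hilbert.
Variable R : realType.

Definition dot_norm (V : lmodType R[i]) (dot : V -> V -> R[i]) (v : V) : R :=
  Num.sqrt (complex.Re (dot v v)).

Record hilbertSpace := HilbertSpace {
  hcarrier :> lmodType R[i];
  (* linear in the first argument, positive definite *)
  inner : {dot hcarrier for @Num.conj R[i]};
  hcomplete : forall u : nat -> hcarrier,
    (forall e : R, 0 < e -> exists N : nat, forall m n : nat,
       (N <= m)%N -> (N <= n)%N -> dot_norm inner (u m - u n) < e) ->
    exists l : hcarrier, forall e : R, 0 < e -> exists N : nat,
      forall n : nat, (N <= n)%N -> dot_norm inner (u n - l) < e }.

Definition hnorm (H : hilbertSpace) (v : H) : R := dot_norm (@inner H) v.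

Definition hclosure (H : hilbertSpace) (S : set H) : set H :=
  [set v | forall e : R, 0 < e -> exists2 w, S w & hnorm (v - w) < e].

Definition closed_span (H : hilbertSpace) (S : set H) : set H :=
  hclosure (span S).

Record unitary_rep (G : groupType) (H : hilbertSpace) := UnitaryRep {
  rho :> G -> {linear H -> H};
  rho_inner : forall g v w, inner H (rho g v) (rho g w) = inner H v w;
  rho1 : forall v, rho 1%g v = v;
  rhoM : forall g h v, rho (g * h)%g v = rho g (rho h v) }.

(* Unitary equivalence of the restrictions of two representations to closed
   invariant subspaces K and K'; U is only relevant on K. *)
Definition unitarily_equivalent (G : groupType) (H H' : hilbertSpace)
    (pi : unitary_rep G H) (K : set H) (pi' : unitary_rep G H') (K' : set H') :
    Prop :=
  exists U : H -> H',
    [/\ (forall v, K v -> K' (U v)) /\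
        (forall w, K' w -> exists2 v, K v & U v = w),
        forall (a : R[i]) v w, K v -> K w -> U (a *: v + w) = a *: U v + U w,
        forall v w, K v -> K w -> inner H' (U v) (U w) = inner H v w &
        forall g v, K v -> U (pi g v) = pi' g (U v)].

(* The Hilbert space completion of the direct limit over trees of the spaces
   C_n, given by its defining property (which determines it up to a unique
   unitary), with its representation of F.  [cls t x] is the class t/x; as the
   inner product is definite, [cls_inner] makes [cls t] factor through C_n, the
   quotient of [Lin 0 n] by the kernel of [gram d]. *)
Record limit_rep (d : R) := LimitRep {
  lspace :> hilbertSpace;
  cls : forall n, ntree n -> {linear Lin R 0 n -> lspace};
  cls_inner : forall n (t : ntree n) (x y : Lin R 0 n),
    inner lspace (cls t x) (cls t y) = gram d x y;
  cls_graft : forall m n (f : forest m n) (s : ntree m) (x : Lin R 0 m),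
    cls (graft f s) (lcomp (vec R (Phi f)) x) = cls s x;
  cls_dense : forall v, hclosure [set w | exists n (t : ntree n) x, w = cls t x] v;
  action : unitary_rep thompsonF lspace;
  action_frac : forall n (s t : ntree n) (x : Lin R 0 n),
    action (frac s t) (cls t x) = cls s x;
  vacuum : lspace;
  vacuumE : vacuum = cls caret ((Num.sqrt d)^-1%:C *: vec R cup_diagram);
  vacuum_unit : inner lspace vacuum vacuum = 1 }.

Definition wysiwyg (d : R) (L : limit_rep d) : set L :=
  closed_span [set v | exists g : thompsonF, v = action L g (vacuum L)].

Definition trivalent_parameters : set R :=
  [set d | (exists2 n : nat, (5 <= n)%N & d = 4 * cos (pi / n%:R) ^+ 2 - 1)
           \/ 3 <= d].

End Hilbert.

Arguments wysiwyg {R d} L.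

(* Main.v *)
(* The generator x0 of F fixes the vacuum Psi, because a vertex slides along the
   string.  Put phi g = <pi(g) Psi, Psi>.  Multiplying by powers of x0 on either
   side, which does not change phi, brings g into the elements supported in
   [1/2, 1] and h into those supported in [0, 1/2]; conjugation by x0 preserves
   the former, and since every diagram in Mor(X, X) is a multiple of the
   identity, phi is multiplicative on products of the two kinds.  Hence
   phi (h x0^k g) = phi h * phi g for k large, which forces every x0-fixed vector
   of the Wysiwyg representation to be a multiple of Psi.  A unitary equivalence
   therefore preserves phi.  But gluing the tree ((12)3)4 to 1((23)4) gives a
   tetrahedron, so that phi takes the value (d - 2) / (d - 1) there, which
   determines d.

   That closed diagrams and diagrams in Mor(X, X) are scalars follows by moving
   every Merge and Cap below every Fork and Cup with the local relations: with at
   most one string at the bottom and as many at the top, no layer can be left. *)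

From HB Require Import structures.
Require Import Defs.
From mathcomp Require Import all_boot all_order all_algebra.
From mathcomp Require Import all_classical all_reals all_analysis.
From mathcomp Require Import complex zify ring lra.
From mathcomp.multinomials Require Import freeg.

Set Implicit Arguments.
Unset Strict Implicit.
Unset Printing Implicit Defensive.

Import Order.TTheory GRing.Theory Num.Theory.
(* [span] would otherwise be that of vector spaces. *)
Import Defs.

Local Open Scope classical_set_scope.
Local Open Scope ring_scope.
Local Open Scope complex_scope.

(** * Linear spans *)

Section Span.
Variables (K : nzRingType) (V : lmodType K) (S : set V).

Lemma span0 : span S 0.
Proof.
exists 0%N, (fun=> 0), (fun=> 0); split; last by rewrite big_ord0.
by case.
Qed.

Lemma spanZ a x : span S x -> span S (a *: x).
Proof.
move=> [n [b [u [Su ->]]]]; exists n, (fun i => a * b i), u; split => //.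
by rewrite scaler_sumr; apply: eq_bigr => i _; rewrite scalerA.
Qed.

Lemma spanD x y : span S x -> span S y -> span S (x + y).
Proof.
move=> [n [b [u [Su ->]]]] [m [c [v [Sv ->]]]].
exists (n + m)%N, (fun i => match fintype.split i with inl j => b j | inr j => c j end),
  (fun i => match fintype.split i with inl j => u j | inr j => v j end); split.
  by move=> i; case: (fintype.split i).
rewrite big_split_ord /=; congr (_ + _); apply: eq_bigr => i _.
  by case: splitP => j /= e; [rewrite (ord_inj e)|case: i e => i /= ? ?; lia].
case: splitP => j /= e; first by case: j e => j /= ? ?; lia.
by have /ord_inj -> : i = j :> nat by lia.
Qed.

Lemma span_sub : S `<=` span S.
Proof.
move=> x Sx; exists 1%N, (fun=> 1), (fun=> x); split => //.
by rewrite big_ord1 scale1r.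
Qed.

End Span.

(** * Rewriting diagrams by the local relations *)

Lemma wf_catP m u v n : wf m (u ++ v) n -> exists2 p, wf m u p & wf p v n.
Proof.
elim: u m => [|[i g] u IH] m /=; first by exists m.
by move=> /andP[-> /IH[p up vp]]; exists p.
Qed.

Definition shift_word s (w : word) : word := [seq ((s + l.1)%N, l.2) | l <- w].

Lemma shift_cat s u v : shift_word s (u ++ v) = shift_word s u ++ shift_word s v.
Proof. exact: map_cat. Qed.

Lemma shift0 w : shift_word 0 w = w.
Proof. by rewrite /shift_word map_id_in // => -[]. Qed.

Section Skein.
Variables (R : realType) (d : R).
Local Notation C := R[i].
Local Notation c := (((d - 1)^-1)%:C).
Implicit Types (u v w : word) (r : seq (C * word)).

Lemma skein_refl m n (x : Lin R m n) : skein_eq d x x.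
Proof. by rewrite /skein_eq subrr; exact: span0. Qed.

Lemma skein_sym m n (x y : Lin R m n) : skein_eq d x y -> skein_eq d y x.
Proof. by rewrite /skein_eq => h; rewrite -opprB -scaleN1r; exact: spanZ. Qed.

Lemma skein_trans m n (x y z : Lin R m n) :
  skein_eq d x y -> skein_eq d y z -> skein_eq d x z.
Proof.
by rewrite /skein_eq => xy yz; rewrite -(subrK y x) -addrA; exact: spanD.
Qed.

Lemma skeinD m n (x y z t : Lin R m n) :
  skein_eq d x y -> skein_eq d z t -> skein_eq d (x + z) (y + t).
Proof. by rewrite /skein_eq => xy zt; rewrite opprD addrACA; exact: spanD. Qed.

Lemma skeinZ a m n (x y : Lin R m n) :
  skein_eq d x y -> skein_eq d (a *: x) (a *: y).
Proof. by rewrite /skein_eq => xy; rewrite -scalerBr; exact: spanZ. Qed.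

(* Junk value 0 on ill-formed words. *)
Definition closed_diagram w : Lin R 0 0 := oapp (@vec R 0 0) 0 (insub w).

(* The quantification over the horizontal position s makes the coefficients of r
   independent of it, as needed to compare values of Mor(X, X) at two places. *)
Definition rew w r : Prop :=
  (forall s m n, wf m (shift_word s w) n -> all (fun p => wf m (shift_word s p.2) n) r) /\
  forall s u v, wf 0 (u ++ shift_word s w ++ v) 0 ->
    skein_eq d (closed_diagram (u ++ shift_word s w ++ v))
      (\sum_(p <- r) p.1 *: closed_diagram (u ++ shift_word s p.2 ++ v)).

Definition rew1 w w' := rew w [:: (1, w')].

Lemma wf_replace w w' u v m n :
  (forall m n, wf m w n -> wf m w' n) ->
  wf m (u ++ w ++ v) n -> wf m (u ++ w' ++ v) n.
Proof.
move=> ww' /wf_catP[p up] /wf_catP[q wq vq].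
by apply: wf_cat up (wf_cat (ww' _ _ wq) vq).
Qed.

(** The last hypothesis solves the relation [rho s] for the term [w], up to the factor [a]. It is
    asked for an arbitrary [F] so that it can be applied with any surrounding words. *)
Lemma rew_relation w r a (rho : nat -> seq (C * word)) :
  (forall s, local_relation d (rho s)) ->
  (forall s m n, wf m (shift_word s w) n ->
     all (fun p => wf m (shift_word s p.2) n) r && all (fun p => wf m p.2 n) (rho s)) ->
  (forall s (F : word -> Lin R 0 0),
     F (shift_word s w) - \sum_(p <- r) p.1 *: F (shift_word s p.2)
     = a *: \sum_(p <- rho s) p.1 *: F p.2) ->
  rew w r.
Proof.
move=> rel wfr lin; split=> [s m n /wfr /andP[]//|s u v uwv].
rewrite /skein_eq (lin s (fun w => closed_diagram (u ++ w ++ v))).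
apply: spanZ; apply: span_sub; exists u, v, (rho s); split => //.
  apply/allP => p pin; apply: wf_replace uwv => m n /wfr /andP[_ /allP]; exact.
by rewrite /lin_of_seq big_map.
Qed.

Lemma rew1_refl w : rew1 w w.
Proof.
split=> [s m n /= ->//|s u v _].
by rewrite big_seq1 scale1r; exact: skein_refl.
Qed.

(** Transitivity of rewriting: each term of [r] is rewritten in its turn and the coefficients
    multiply. *)
Lemma rew_flatten w r (P : word -> Prop) :
  rew w r ->
  (forall p, p \in r -> exists2 r', rew p.2 r' & forall q, q \in r' -> P q.2) ->
  exists2 r', rew w r' & forall q, q \in r' -> P q.2.
Proof.
move=> [wfw eqw] rP.
(* Freed from [w], the claim concerns only the list [r] and can be proved by induction on it. *)
suff [r' [wf' eq' P']] : exists r', [/\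
    forall s m n, all (fun p => wf m (shift_word s p.2) n) r ->
      all (fun p => wf m (shift_word s p.2) n) r',
    forall s u v, all (fun p => wf 0 (u ++ shift_word s p.2 ++ v) 0) r ->
      skein_eq d (\sum_(p <- r) p.1 *: closed_diagram (u ++ shift_word s p.2 ++ v))
        (\sum_(p <- r') p.1 *: closed_diagram (u ++ shift_word s p.2 ++ v)) &
    forall q, q \in r' -> P q.2].
  exists r' => //; split=> [s m n /wfw /wf'//|s u v uwv].
  apply: skein_trans (eqw _ _ _ uwv) _; apply: eq'.
  apply/allP => p pin; apply: wf_replace uwv => m n /wfw /allP; exact.
elim: r {wfw eqw} rP => [|p r IH] rP.
  by exists [::]; split => // s u v _; exact: skein_refl.
have [q qin|r' [wf' eq' P']] := IH; first by apply: rP; rewrite inE qin orbT.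
have [|t [wft eqt] Pt] := rP p; first by rewrite inE eqxx.
exists ([seq (p.1 * q.1, q.2) | q <- t] ++ r'); split.
- move=> s m n /= /andP[pw rw]; rewrite all_cat wf' // andbT all_map.
  exact: wft pw.
- move=> s u v /= /andP[pw rw]; rewrite big_cons big_cat /= big_map.
  apply: skeinD; last exact: eq'.
  have -> : \sum_(q <- t) (p.1 * q.1) *: closed_diagram (u ++ shift_word s q.2 ++ v)
      = p.1 *: \sum_(q <- t) q.1 *: closed_diagram (u ++ shift_word s q.2 ++ v).
    by rewrite scaler_sumr; apply: eq_bigr => q _; rewrite scalerA.
  by apply: skeinZ; exact: eqt.
- move=> q; rewrite mem_cat => /orP[/mapP[x xt ->]|]; last exact: P'.
  exact: (Pt x xt).
Qed.

Lemma rew_ctx a b w r : rew w r -> rew (a ++ w ++ b) [seq (p.1, a ++ p.2 ++ b) | p <- r].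
Proof.
move=> [wfw eqw]; split=> [s m n|s u v].
  rewrite !shift_cat => wfs; rewrite all_map; apply/allP => p pin /=.
  rewrite !shift_cat; apply: wf_replace wfs => m' n' /wfw /allP; exact.
rewrite !shift_cat big_map => h; under eq_bigr => p _ do rewrite /= !shift_cat.
have e x : u ++ (shift_word s a ++ x ++ shift_word s b) ++ v =
    (u ++ shift_word s a) ++ x ++ (shift_word s b ++ v) by rewrite !catA.
rewrite e; under eq_bigr => p _ do rewrite e.
by apply: eqw; rewrite -e.
Qed.

Lemma rew1_ctx a b w w' : rew1 w w' -> rew1 (a ++ w ++ b) (a ++ w' ++ b).
Proof. exact: rew_ctx. Qed.

Lemma rew1_rew w w' r : rew1 w w' -> rew w' r -> rew w r.
Proof.
move=> [wfw eqw] [wfw' eqw']; split=> [s m n /wfw /= /andP[/wfw']//|s u v h].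
apply: skein_trans (eqw _ _ _ h) _; rewrite big_seq1 scale1r; apply: eqw'.
by apply: wf_replace h => m n /wfw /andP[].
Qed.

(** Removing a zigzag or a bigon also removes the evidence that its string exists, so
    well-formedness has to be supplied for the way back. *)
Lemma rew1_sym w w' :
  (forall s m n, wf m (shift_word s w') n -> wf m (shift_word s w) n) ->
  rew1 w w' -> rew1 w' w.
Proof.
move=> h [_ eqw]; split=> [s m n /h /= ->//|s u v h'].
rewrite big_seq1 scale1r; apply: skein_sym.
have /eqw : wf 0 (u ++ shift_word s w ++ v) 0 by apply: wf_replace h' => m n; exact: h.
by rewrite big_seq1 scale1r.
Qed.

Ltac wf_lia := let s := fresh in let m := fresh in let n := fresh in
  move=> s m n /=; rewrite ?andbT; lia.

Lemma rew_relation1 w w' :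
  (forall s, local_relation d [:: (1, shift_word s w); (-1, shift_word s w')]) ->
  (forall s m n, wf m (shift_word s w) n -> wf m (shift_word s w') n) ->
  rew1 w w'.
Proof.
move=> rel wfw; apply: (rew_relation (a := 1) rel) => [s m n h|s F] /=.
  by rewrite h wfw.
by rewrite scale1r !big_cons !big_nil !scale1r !addr0 scaleN1r.
Qed.

Lemma rew_exchange i j j' g h :
  (i + legs_out g <= j)%N -> (j' + legs_out g = j + legs_in g)%N ->
  rew1 [:: (i, g); (j, h)] [:: (j', h); (i, g)].
Proof.
move=> ij jj'; apply: rew_relation1 => [s|s m n /=].
  rewrite /shift_word /=.
  have -> : (s + j = s + i + legs_out g + (j - legs_out g - i))%N by lia.
  have -> : (s + j' = s + i + legs_in g + (j - legs_out g - i))%N by lia.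
  exact: exchange.
by case: g ij jj'; case: h => /=; lia.
Qed.

Lemma rew_exchange_sym i j j' g h :
  (i + legs_out g <= j)%N -> (j' + legs_out g = j + legs_in g)%N ->
  rew1 [:: (j', h); (i, g)] [:: (i, g); (j, h)].
Proof.
move=> ij jj'; apply: rew1_sym (rew_exchange _ ij jj') => s m n /=.
by case: g ij jj'; case: h => /=; lia.
Qed.

Lemma rew_zigzag_left i : rew1 [:: (i.+1, Cup); (i, Cap)] [::].
Proof.
apply: rew_relation1 => [s|]; last by wf_lia.
by rewrite /shift_word /= addnS; exact: zigzag_left.
Qed.

Lemma rew_zigzag_right i : rew1 [:: (i, Cup); (i.+1, Cap)] [::].
Proof.
apply: rew_relation1 => [s|]; last by wf_lia.
by rewrite /shift_word /= addnS; exact: zigzag_right.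
Qed.

Lemma rew_turn_left i : rew1 [:: (i.+1, Fork); (i, Cap)] [:: (i, Merge)].
Proof.
apply: rew_relation1 => [s|]; last by wf_lia.
by rewrite /shift_word /= addnS; exact: turn_left.
Qed.

Lemma rew_turn_right i : rew1 [:: (i, Fork); (i.+1, Cap)] [:: (i, Merge)].
Proof.
apply: rew_relation1 => [s|]; last by wf_lia.
by rewrite /shift_word /= addnS; exact: turn_right.
Qed.

Lemma rew_unturn_left i : rew1 [:: (i, Merge)] [:: (i.+1, Fork); (i, Cap)].
Proof. by apply: rew1_sym (rew_turn_left i); wf_lia. Qed.

Lemma rew_unturn_right i : rew1 [:: (i, Merge)] [:: (i, Fork); (i.+1, Cap)].
Proof. by apply: rew1_sym (rew_turn_right i); wf_lia. Qed.

Lemma rew_bigon i : rew1 [:: (i, Fork); (i, Merge)] [::].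
Proof.
apply: rew_relation1 => [s|]; last by wf_lia.
by rewrite /shift_word /=; exact: bigon.
Qed.

Lemma rew_loop i : rew [:: (i, Cup); (i, Cap)] [:: (d%:C, [::])].
Proof.
apply: (rew_relation (a := 1) (fun s => loop d (s + i))).
  by wf_lia.
move=> s F; rewrite !big_cons !big_nil /=.
by rewrite !scale1r !addr0 scaleNr.
Qed.

Lemma rew_lollipop i : rew [:: (i, Fork); (i, Cap)] [::].
Proof.
apply: (rew_relation (a := 1) (fun s => lollipop d (s + i))).
  by wf_lia.
by move=> s F; rewrite !big_cons !big_nil /= !scale1r subr0 addr0.
Qed.

Lemma rew_triangle i : rew [:: (i, Fork); (i, Fork); (i.+1, Merge)]
  [:: (((d - 2) / (d - 1))%:C, [:: (i, Fork)])].
Proof.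
apply: (rew_relation (a := 1) (fun s => triangle d (s + i))).
  by wf_lia.
move=> s F; rewrite !big_cons !big_nil /= addnS.
by rewrite !scale1r !addr0 scaleNr.
Qed.

(** The relation is solved for H, its only term with a Fork or Cup below a Merge or Cap; hence
    [a := -1]. *)
Lemma rew_H i : rew [:: (i, Fork); (i.+1, Merge)]
  [:: (1, [:: (i, Merge); (i, Fork)]); (- c, [::]); (c, [:: (i, Cap); (i, Cup)])].
Proof.
apply: (rew_relation (a := -1) (fun s => I_minus_H d (s + i))).
  by wf_lia.
move=> s F; rewrite !big_cons !big_nil /= addnS.
by rewrite !scaleN1r !scale1r !addr0 !opprD !opprK addrCA.
Qed.

(** * Normal ordering of diagrams *)

Lemma rew1_trans w1 w2 w3 : rew1 w1 w2 -> rew1 w2 w3 -> rew1 w1 w3.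
Proof. exact: rew1_rew. Qed.

(* Create a zigzag on the right leg, rotate the vertex through it, and then
   straighten the left leg. *)
Lemma rew_cup_fork i : rew1 [:: (i, Cup); (i.+1, Fork)] [:: (i, Cup); (i, Fork)].
Proof.
apply: (rew1_trans (w2 := [:: (i, Cup); (i.+1, Fork); (i.+3, Cup); (i.+2, Cap)])).
  apply: rew1_sym (rew1_ctx [:: (i, Cup); (i.+1, Fork)] [::] (rew_zigzag_left i.+2)).
  by move=> s m n /=; lia.
have ex : rew1 [:: (i.+1, Fork); (i.+3, Cup)] [:: (i.+2, Cup); (i.+1, Fork)].
  by apply: rew_exchange => /=; lia.
apply: (rew1_trans (rew1_ctx [:: (i, Cup)] [:: (i.+2, Cap)] ex)) => /=.
apply: (rew1_trans (rew1_ctx [:: (i, Cup); (i.+2, Cup)] [::] (rew_turn_right i.+1))).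
apply: (rew1_trans (rew1_ctx [:: (i, Cup); (i.+2, Cup)] [::] (rew_unturn_left i.+1))).
have ex' : rew1 [:: (i, Cup); (i.+2, Cup)] [:: (i, Cup); (i, Cup)].
  by apply: rew_exchange => /=; lia.
apply: (rew1_trans (rew1_ctx [::] [:: (i.+2, Fork); (i.+1, Cap)] ex')) => /=.
have ex2 : rew1 [:: (i, Cup); (i.+2, Fork)] [:: (i, Fork); (i, Cup)].
  by apply: rew_exchange => /=; lia.
apply: (rew1_trans (rew1_ctx [:: (i, Cup)] [:: (i.+1, Cap)] ex2)) => /=.
exact: (rew1_ctx [:: (i, Cup); (i, Fork)] [::] (rew_zigzag_right i)).
Qed.

Lemma rew_cup_fork_sym i : rew1 [:: (i, Cup); (i, Fork)] [:: (i, Cup); (i.+1, Fork)].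
Proof. by apply: rew1_sym (rew_cup_fork i) => s m n /=; lia. Qed.

(** The Merge opens into a Fork and a Cap; the Fork slides along the cup to its other leg, where it
    meets the Cap in a lollipop. *)
Lemma rew_cup_merge i : rew [:: (i, Cup); (i, Merge)] [::].
Proof.
apply: rew1_rew (rew1_ctx [:: (i, Cup)] [::] (rew_unturn_right i)) _.
apply: rew1_rew (rew1_ctx [::] [:: (i.+1, Cap)] (rew_cup_fork_sym i)) _.
exact: (rew_ctx [:: (i, Cup)] [::] (rew_lollipop i.+1)).
Qed.

(** The Merge opens into a Fork and a Cap; the Fork drops below the cup, and cup and cap straighten
    as a zigzag. *)
Lemma rew_cup_mergeS i : rew1 [:: (i, Cup); (i.+1, Merge)] [:: (i, Fork)].
Proof.
apply: rew1_rew (rew1_ctx [:: (i, Cup)] [::] (rew_unturn_left i.+1)) _ => /=.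
have ex : rew1 [:: (i, Cup); (i.+2, Fork)] [:: (i, Fork); (i, Cup)].
  by apply: rew_exchange => /=; lia.
apply: rew1_rew (rew1_ctx [::] [:: (i.+1, Cap)] ex) _ => /=.
exact: (rew1_ctx [:: (i, Fork)] [::] (rew_zigzag_right i)).
Qed.

Lemma rew_cupS_merge i : rew1 [:: (i.+1, Cup); (i, Merge)] [:: (i, Fork)].
Proof.
apply: rew1_rew (rew1_ctx [:: (i.+1, Cup)] [::] (rew_unturn_right i)) _ => /=.
have ex : rew1 [:: (i.+1, Cup); (i, Fork)] [:: (i, Fork); (i.+2, Cup)].
  by apply: rew_exchange_sym => /=; lia.
apply: rew1_rew (rew1_ctx [::] [:: (i.+1, Cap)] ex) _ => /=.
exact: (rew1_ctx [:: (i, Fork)] [::] (rew_zigzag_left i.+1)).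
Qed.

(** The bar of H may slope either way: once the Merge is opened, two Forks on distinct strings
    exchange heights. *)
Lemma rew_H_flip i :
  rew1 [:: (i.+1, Fork); (i, Merge)] [:: (i, Fork); (i.+1, Merge)].
Proof.
apply: rew1_rew (rew1_ctx [:: (i.+1, Fork)] [::] (rew_unturn_right i)) _ => /=.
have ex : rew1 [:: (i.+1, Fork); (i, Fork)] [:: (i, Fork); (i.+2, Fork)].
  by apply: rew_exchange_sym => /=; lia.
apply: rew1_rew (rew1_ctx [::] [:: (i.+1, Cap)] ex) _ => /=.
exact: (rew1_ctx [:: (i, Fork)] [::] (rew_turn_left i.+1)).
Qed.

(** The pieces that increase the number of strings; the other two decrease it. *)
Definition up (l : layer) : bool := if l.2 is (Cup | Fork) then true else false.

Definition normal_word w : bool := sorted (fun a b => up a ==> up b) w.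

(** What may replace an up-down pair. Never exceeding two layers is what lets the induction for
    normal ordering terminate; the second layer is unconstrained. *)
Definition sorted_pair w : bool :=
  match w with
  | [::] | [:: _] => true
  | [:: a; b] => ~~ up a
  | _ => false
  end.

(** The two upper legs of [a] face the two lower legs of [b]. If they share no string, the pieces
    exchange heights; if they share one or both, each of the twelve cases is a local relation or a
    consequence of some. *)
Lemma rew_up_down a b : up a -> ~~ up b ->
  exists2 r, rew [:: a; b] r & forall q, q \in r -> sorted_pair q.2.
Proof.
have single w : rew1 [:: a; b] w -> sorted_pair w ->
    exists2 r, rew [:: a; b] r & forall q, q \in r -> sorted_pair q.2.
  by move=> h sw; exists [:: (1, w)] => // q; rewrite inE => /eqP ->.
have zero : rew [:: a; b] [::] ->
    exists2 r, rew [:: a; b] r & forall q, q \in r -> sorted_pair q.2.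
  by move=> h; exists [::].
case: a b single zero => [i g] [j h] single zero ug dh.
have [ij|ji] := leqP (i + 2) j.
  apply: (single [:: ((j - 2 + legs_in g)%N, h); (i, g)]) => //.
  by apply: rew_exchange; case: g ug {single zero} => //= _; lia.
have [ji2|ij] := leqP (j + 2) i.
  apply: (single [:: (j, h); ((i - 2 + legs_out h)%N, g)]) => //.
  by apply: rew_exchange_sym; case: h dh {single zero} => //= _; lia.
have [e|[e|e]] : j = i \/ j = i.+1 \/ i = j.+1 by lia.
- subst j; case: g ug single zero => // _; case: h dh => // _ single zero.
  + exists [:: (d%:C, [::])]; first exact: rew_loop.
    by move=> q; rewrite inE => /eqP ->.
  + by apply: zero; exact: rew_cup_merge.
  + by apply: zero; exact: rew_lollipop.
  + by apply: (single [::]) => //; exact: rew_bigon.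
- subst j; case: g ug single zero => // _; case: h dh => // _ single zero.
  + by apply: (single [::]) => //; exact: rew_zigzag_right.
  + by apply: (single [:: (i, Fork)]) => //; exact: rew_cup_mergeS.
  + by apply: (single [:: (i, Merge)]) => //; exact: rew_turn_right.
  + exists [:: (1, [:: (i, Merge); (i, Fork)]); (- c, [::]); (c, [:: (i, Cap); (i, Cup)])].
      exact: rew_H.
    by move=> q; rewrite !inE => /or3P[] /eqP ->.
- subst i; case: g ug single zero => // _; case: h dh => // _ single zero.
  + by apply: (single [::]) => //; exact: rew_zigzag_left.
  + by apply: (single [:: (j, Fork)]) => //; exact: rew_cupS_merge.
  + by apply: (single [:: (j, Merge)]) => //; exact: rew_turn_left.
  + exists [:: (1, [:: (j, Merge); (j, Fork)]); (- c, [::]); (c, [:: (j, Cap); (j, Cup)])].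
      by apply: rew1_rew (rew_H _); exact: rew_H_flip.
    by move=> q; rewrite !inE => /or3P[] /eqP ->.
Qed.

Definition normalizes w := exists2 r, rew w r & forall q, q \in r -> normal_word q.2.

Lemma normal_normalizes w : normal_word w -> normalizes w.
Proof.
move=> nw; exists [:: (1, w)]; first exact: rew1_refl.
by move=> q; rewrite inE => /eqP ->.
Qed.

Lemma normal_cons a w : ~~ up a -> normal_word w -> normal_word (a :: w).
Proof. by move=> /negbTE da; case: w => //= b w; rewrite /normal_word /= da. Qed.

Lemma normalizes_cons_down a w : ~~ up a -> normalizes w -> normalizes (a :: w).
Proof.
move=> da [r wr nr]; exists [seq (p.1, [:: a] ++ p.2 ++ [::]) | p <- r].
  by rewrite -[w]cats0; exact: (rew_ctx [:: a] [::] wr).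
by move=> q /mapP[p pr ->] /=; rewrite cats0; apply: normal_cons (nr _ pr).
Qed.

(** Rewriting the two lowest layers leaves at most one layer on the shorter word [w], possibly with
    a down piece below it; the induction hypothesis holds for every first layer. *)
Lemma normalizes_cons_normal a w : normal_word w -> normalizes (a :: w).
Proof.
elim: w a => [|b w IH] a nw; first exact: normal_normalizes.
case: (boolP (up a)) => [ua|da]; last first.
  by apply: normal_normalizes; exact: normal_cons.
case: (boolP (up b)) => [ub|db].
  by apply: normal_normalizes; rewrite /normal_word /= ub implybT.
have {}nw : normal_word w by apply: path_sorted nw.
have [r abr Sr] := rew_up_down ua db.
apply: (rew_flatten (P := fun w => normal_word w) (rew_ctx [::] w abr)) => p /mapP[q qr ->] /=.
case: q.2 (Sr _ qr) => [|x [|y [|z t]]] //=.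
- by move=> _; exact: normal_normalizes.
- by move=> _; exact: IH.
- by move=> dx; apply: normalizes_cons_down dx _; exact: IH.
Qed.

Lemma rew_normal w : normalizes w.
Proof.
elim: w => [|a w [r wr nr]]; first exact: normal_normalizes.
rewrite -[w]cats0; apply: (rew_flatten (P := fun w => normal_word w) (rew_ctx [:: a] [::] wr)).
by move=> p /mapP[q qr ->] /=; rewrite cats0; apply: normalizes_cons_normal (nr _ qr).
Qed.

Lemma wf_up w m n : all up w -> wf m w n -> (m + size w <= n)%N.
Proof.
elim: w m => [|[i g] w IH] m /=; first by rewrite addn0 => _ /eqP ->.
by move=> /andP[ug /IH{}IH] /andP[im /IH]; case: g ug im => //= _; lia.
Qed.

(* At most one string leaves no room for a Merge or a Cap at the bottom, and
   Fork and Cup only add strings. *)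
Lemma normal_small w m : (m <= 1)%N -> normal_word w -> wf m w m -> w = [::].
Proof.
move=> m1; case: w => [|a w] // nw wfw; suff aw : all up (a :: w).
  by have := wf_up aw wfw; rewrite /=; lia.
have ua : up a by case: a {nw} wfw => i [] //=; lia.
rewrite /= ua /=; move: nw; rewrite /normal_word /= (path_sortedE _ a w); last first.
  by move=> x y z; rewrite /up; case: x.2; case: y.2; case: z.2.
by rewrite ua => /andP[].
Qed.

(** All normal terms are empty, so the scalar is the sum of their coefficients; it is chosen before
    the position and the context. *)
Lemma scalar_diagram w m : (m <= 1)%N -> wf m w m ->
  exists a : C, forall s u v, wf 0 (u ++ shift_word s w ++ v) 0 ->
    skein_eq d (closed_diagram (u ++ shift_word s w ++ v)) (a *: closed_diagram (u ++ v)).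
Proof.
move=> m1 wfw; have [r [wfr eqr] nr] := rew_normal w.
have r0 p : p \in r -> p.2 = [::].
  move=> pr; apply: normal_small m1 (nr _ pr) _.
  by have := wfr 0%N m m; rewrite !shift0 => /(_ wfw) /allP /(_ _ pr); rewrite shift0.
exists (\sum_(p <- r) p.1) => s u v /eqr; rewrite scaler_suml.
by under eq_big_seq => p /r0 -> do [].
Qed.
End Skein.

(** * Values of closed diagrams *)

Lemma mirror_word_cat u v : mirror_word (u ++ v) = mirror_word v ++ mirror_word u.
Proof. by rewrite /mirror_word map_cat rev_cat. Qed.

Lemma mirror_word_shift s w : mirror_word (shift_word s w) = shift_word s (mirror_word w).
Proof. by rewrite /mirror_word /shift_word map_rev -!map_comp. Qed.

Lemma tree_word_shift s i t : tree_word (s + i) t = shift_word s (tree_word i t).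
Proof.
elim: t i => [|l IHl r IHr] i //=.
by rewrite -addnA IHl IHr -shift_cat.
Qed.

(** For trees with equally many leaves, the endomorphism of X obtained by composing the diagram of
    [q] with the adjoint of that of [p]. *)
Definition bubble (p q : tree) : word := tree_word 0 q ++ mirror_word (tree_word 0 p).

Lemma wf_bubble p q : leaves p = leaves q -> wf 1 (bubble p q) 1.
Proof.
move=> pq; have := wf_tree_word 0 q 0; have := wf_mirror (wf_tree_word 0 p 0).
by rewrite !addn0 !add0n pq => hp hq; exact: wf_cat hq hp.
Qed.

(* The diagram of [Node a b] closed off with the mirror image of that of
   [Node a' b'], the roots being replaced with a cup and a cap; its value is
   d times <pi(g) Psi, Psi> for g the fraction of the two trees. *)
Definition pairing_word (a' b' a b : tree) : word :=
  (0%N, Cup) :: (tree_word 0 a ++ tree_word (leaves a) b)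
  ++ mirror_word (tree_word 0 a' ++ tree_word (leaves a') b') ++ [:: (0%N, Cap)].

Lemma wf_pairing a b a' b' : (leaves a + leaves b = leaves a' + leaves b')%N ->
  wf 0 (pairing_word a' b' a b) 0.
Proof.
have h x y : wf 2 (tree_word 0 x ++ tree_word (leaves x) y) (leaves x + leaves y).
  apply: wf_cat (wf_tree_word 0 x 1) _; have := wf_tree_word (leaves x) y 0.
  by rewrite !addn0.
move=> e; rewrite /pairing_word /=; apply: wf_cat (h a b) _; rewrite e.
by apply: wf_cat (wf_mirror (h a' b')) _.
Qed.

Section Evaluation.
Variables (R : realType) (d : R).
Local Notation C := R[i].
Implicit Types (u v w : word).

Definition evaluates w (x : C) := skein_eq d (closed_diagram R w) (x *: closed_diagram R [::]).

Definition bubble_value (p q : tree) (x : C) : Prop :=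
  forall s u v, wf 0 (u ++ shift_word s (bubble p q) ++ v) 0 ->
    skein_eq d (closed_diagram R (u ++ shift_word s (bubble p q) ++ v)) (x *: closed_diagram R (u ++ v)).

Lemma bubble_valueP p q : leaves p = leaves q -> exists x, bubble_value p q x.
Proof. by move=> /wf_bubble; exact: scalar_diagram. Qed.

Lemma bubble_value_leaf : bubble_value Leaf Leaf 1.
Proof. by move=> s u v _; rewrite scale1r; exact: skein_refl. Qed.

Lemma evaluates_rew a b w r x : rew d w r -> wf 0 (a ++ w ++ b) 0 ->
  skein_eq d (\sum_(p <- r) p.1 *: closed_diagram R (a ++ p.2 ++ b)) (x *: closed_diagram R [::]) ->
  evaluates (a ++ w ++ b) x.
Proof.
move=> [_ eqw] wfw; have := eqw 0%N a b; rewrite shift0 => /(_ wfw) h.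
apply: skein_trans; under eq_bigr => p _ do rewrite -(shift0 p.2); exact: h.
Qed.

Lemma evaluates_rew1 a b w w' x : rew1 d w w' -> wf 0 (a ++ w ++ b) 0 ->
  evaluates (a ++ w' ++ b) x -> evaluates (a ++ w ++ b) x.
Proof.
by move=> ww' wfw h; apply: evaluates_rew ww' wfw _; rewrite big_seq1 scale1r.
Qed.

Lemma evaluates_rewZ a b w w' x y : rew d w [:: (y, w')] -> wf 0 (a ++ w ++ b) 0 ->
  evaluates (a ++ w' ++ b) x -> evaluates (a ++ w ++ b) (y * x).
Proof.
move=> ww' wfw h; apply: evaluates_rew ww' wfw _; rewrite big_seq1 -scalerA.
exact: skeinZ.
Qed.

Lemma evaluates_loop : evaluates [:: (0%N, Cup); (0%N, Cap)] d%:C.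
Proof.
rewrite -[d%:C]mulr1; apply: (evaluates_rewZ (a := [::]) (b := [::]) (rew_loop d 0)) => //.
by rewrite /evaluates scale1r; exact: skein_refl.
Qed.

(** Reflection reverses the order of layers, so [b] and the mirror of [b'] are adjacent; equal
    numbers of leaves on the left align them into a bubble. *)
Lemma pairing_wordE a b a' b' : leaves a = leaves a' ->
  pairing_word a' b' a b = ((0%N, Cup) :: tree_word 0 a)
   ++ shift_word (leaves a) (bubble b' b) ++ mirror_word (tree_word 0 a') ++ [:: (0%N, Cap)].
Proof.
move=> aa'; rewrite /pairing_word /bubble /= mirror_word_cat shift_cat.
rewrite -mirror_word_shift -!tree_word_shift -aa' addn0.
by rewrite -!catA.
Qed.

(** Removing the right bubble and then the left one leaves a loop. *)
Lemma evaluates_pairing a b a' b' x y :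
  leaves a = leaves a' -> leaves b = leaves b' ->
  bubble_value a' a x -> bubble_value b' b y ->
  evaluates (pairing_word a' b' a b) (y * (x * d%:C)).
Proof.
move=> aa' bb' ax bY; have := wf_pairing (f_equal2 addn aa' bb').
rewrite (pairing_wordE _ _ aa') => wfw.
apply: skein_trans (bY _ _ _ wfw) _; rewrite -scalerA; apply: skeinZ.
have := wf_pairing (f_equal2 addn aa' (erefl (leaves Leaf))).
rewrite (pairing_wordE _ _ aa') /= => {}wfw.
have := ax 0%N [:: (0%N, Cup)] [:: (0%N, Cap)]; rewrite shift0 /bubble -catA /=.
move=> /(_ wfw) h; apply: skein_trans h _; rewrite -scalerA; apply: skeinZ.
exact: evaluates_loop.
Qed.

(** The Fork slides to the right leg of the cup and forms a bigon with the Merge. *)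
Lemma evaluates_theta :
  evaluates (pairing_word Leaf (Node Leaf Leaf) (Node Leaf Leaf) Leaf) d%:C.
Proof.
apply: (evaluates_rew1 (a := [::]) (b := [:: (1%N, Merge); (0%N, Cap)]) (rew_cup_fork_sym d 0)) => //.
apply: (evaluates_rew1 (a := [:: (0%N, Cup)]) (b := [:: (0%N, Cap)]) (rew_bigon d 1)) => //.
exact: evaluates_loop.
Qed.

(** Contracting the triangle of the two Forks and the lower Merge leaves the theta graph. *)
Lemma evaluates_tetrahedron :
  evaluates (pairing_word Leaf (Node (Node Leaf Leaf) Leaf) (Node (Node Leaf Leaf) Leaf) Leaf)
    (((d - 2) / (d - 1))%:C * d%:C).
Proof.
apply: (evaluates_rewZ (a := [:: (0%N, Cup)]) (b := [:: (1%N, Merge); (0%N, Cap)])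
  (rew_triangle d 0)) => //.
exact: evaluates_theta.
Qed.

Lemma lcomp_vec m n p (v : diagram n p) (u : diagram m n) :
  lcomp (vec R v) (vec R u) = vec R (stack v u).
Proof. by rewrite /lcomp /vec !liftU !scale1r. Qed.

Lemma lstar_vec m n (D : diagram m n) : lstar (vec R D) = vec R (mirror D).
Proof. by rewrite /lstar /vec domU1 big_seq1 coeffU eqxx mulr1 rmorph1 scale1r. Qed.

Lemma lstar0 m n : lstar (0 : Lin R m n) = 0.
Proof. by rewrite /lstar dom0 big_nil. Qed.

Lemma lcomp0 m n p (x : Lin R m n) : lcomp (0 : Lin R n p) x = 0.
Proof.
pose f (v : diagram n p) := fglift (fun u : diagram m n => vec R (stack v u)) x.
by have := lift_is_additive f 0 0; rewrite !subrr.
Qed.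

Lemma closed_diagram_val (D : diagram 0 0) : closed_diagram R (val D) = vec R D.
Proof. by rewrite /closed_diagram valK. Qed.

Lemma closed_diagram_nil : closed_diagram R [::] = vec R empty_diagram.
Proof. exact: (closed_diagram_val empty_diagram). Qed.

End Evaluation.

(** * The generator x0 of F *)

Lemma leaves_gt0 t : (0 < leaves t)%N.
Proof. by elim: t => //= l IHl r IHr; rewrite addn_gt0 IHl. Qed.

(* Junk value 1 on trees with different numbers of leaves. *)
Definition fraction (s t : tree) : thompsonF :=
  oapp (\pi_thompsonF)%qT 1%g (insub (s, t) : option tree_pair).

Lemma fractionE s t (st : leaves s == leaves t) : fraction s t = pair_frac st.
Proof.
by rewrite /fraction insubT.
Qed.

Lemma fractionP (x : thompsonF) : exists s t, leaves s = leaves t /\ x = fraction s t.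
Proof.
move: x; apply: pair_fracW => s t st; exists s, t.
by rewrite fractionE (eqP st).
Qed.

Lemma fraction_mul r s t : leaves r = leaves s -> leaves s = leaves t ->
  (fraction r s * fraction s t)%g = fraction r t.
Proof.
move=> /eqP rs /eqP st; have rt : leaves r == leaves t by rewrite (eqP rs).
by rewrite !fractionE; exact: mulF_frac.
Qed.

Lemma fraction_attach f s t : leaves s = leaves t -> size f = leaves s ->
  fraction (attach f s) (attach f t) = fraction s t.
Proof.
move=> /eqP st sf; have := leaves_attach_pair st sf => st'.
by rewrite !fractionE; exact: pair_frac_attach.
Qed.

Lemma fraction1 t : fraction t t = 1%g.
Proof. by rewrite fractionE; symmetry; exact: oneF_frac. Qed.

Definition x0 := fraction (Node Leaf (Node Leaf Leaf)) (Node (Node Leaf Leaf) Leaf).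

Lemma fraction_rotate a b c : fraction (Node a (Node b c)) (Node (Node a b) c) = x0.
Proof. exact: (@fraction_attach [:: a; b; c]
  (Node Leaf (Node Leaf Leaf)) (Node (Node Leaf Leaf) Leaf)). Qed.

(** Both factors expand so as to share the middle tree [Node a' b]. *)
Lemma fraction_node a b a' b' : leaves a = leaves a' -> leaves b = leaves b' ->
  fraction (Node a b) (Node a' b')
  = (fraction (Node a Leaf) (Node a' Leaf) * fraction (Node Leaf b) (Node Leaf b'))%g.
Proof.
move=> aa' bb'.
have attach_left s : leaves s = leaves a ->
    attach (nseq (leaves a) Leaf ++ [:: b]) (Node s Leaf) = Node s b.
  by move=> sa /=; rewrite take_size_cat ?drop_size_cat ?size_nseq // attach_nseq.
have attach_right s : leaves s = leaves b ->
    attach (a' :: nseq (leaves b) Leaf) (Node Leaf s) = Node a' s.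
  by move=> sb /=; rewrite drop0 attach_nseq.
rewrite -(@fraction_attach (nseq (leaves a) Leaf ++ [:: b]) (Node a Leaf)); last 2 first.
- by rewrite /= aa'.
- by rewrite size_cat size_nseq.
rewrite -(@fraction_attach (a' :: nseq (leaves b) Leaf) (Node Leaf b)); last 2 first.
- by rewrite /= bb'.
- by rewrite /= size_nseq.
by rewrite !attach_left ?attach_right // fraction_mul //= ?aa' ?bb'.
Qed.

(** Each rotation shortens the left spine by one, until the left subtree is a leaf. *)
Lemma rotate_right a b : exists i c, leaves (Node Leaf c) = leaves (Node a b) /\
  fraction (Node Leaf c) (Node a b) = (x0 ^+ i)%g.
Proof.
elim: a b => [|a IH a' _] b; first by exists 0%N, b; rewrite expg0 fraction1.
have [i [c [lc ec]]] := IH (Node a' b).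
exists i.+1, c; split; first by rewrite lc /= addnA.
rewrite expgSr -ec -(fraction_rotate a a' b) fraction_mul //=.
by rewrite addnA.
Qed.

Lemma rotate_left a b : exists i c, leaves (Node a b) = leaves (Node c Leaf) /\
  fraction (Node a b) (Node c Leaf) = (x0 ^+ i)%g.
Proof.
elim: b a => [|b _ b' IH] a; first by exists 0%N, a; rewrite expg0 fraction1.
have [i [c [lc ec]]] := IH (Node a b).
exists i.+1, c; split; first by rewrite -lc /= addnA.
rewrite expgS -ec -(fraction_rotate a b b') fraction_mul //=.
by rewrite addnA.
Qed.

Lemma fraction_nodeP (g : thompsonF) : exists a b a' b',
  leaves (Node a' b') = leaves (Node a b) /\ g = fraction (Node a' b') (Node a b).
Proof.
have [s [t [st ->]]] := fractionP g.
case: s t st => [|a' b'] [|a b] st; last by exists a, b, a', b'.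
- by exists Leaf, Leaf, Leaf, Leaf; rewrite !fraction1.
- by have := leaves_gt0 a; have := leaves_gt0 b; move: st => /=; lia.
- by have := leaves_gt0 a'; have := leaves_gt0 b'; move: st => /=; lia.
Qed.

(* Up to powers of [x0], every element fixes the left half of [0, 1]. *)
Lemma right_form (g : thompsonF) : exists i j p q, leaves p = leaves q /\
  (x0 ^+ i * g = fraction (Node Leaf p) (Node Leaf q) * x0 ^+ j)%g.
Proof.
have [a [b [a' [b' [e ->]]]]] := fraction_nodeP g.
have [i [p [lp ep]]] := rotate_right a' b'.
have [j [q [lq eq]]] := rotate_right a b.
exists i, j, p, q; split; first by move: e lp lq => /=; lia.
by rewrite -ep -eq !fraction_mul // ?lp ?lq ?e.
Qed.

Lemma left_form (h : thompsonF) : exists i j p q, leaves p = leaves q /\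
  (h * x0 ^+ i = x0 ^+ j * fraction (Node p Leaf) (Node q Leaf))%g.
Proof.
have [a [b [a' [b' [e ->]]]]] := fraction_nodeP h.
have [i [q [lq eq]]] := rotate_left a b.
have [j [p [lp ep]]] := rotate_left a' b'.
exists i, j, p, q; split; first by move: e; rewrite lq lp /=; lia.
by rewrite -ep -eq !fraction_mul // -?lp -?lq ?e.
Qed.

Lemma x0_shift k p q : leaves p = leaves q -> exists p' q', leaves p' = leaves q' /\
  (x0 ^+ k * fraction (Node Leaf p) (Node Leaf q)
   = fraction (Node Leaf p') (Node Leaf q') * x0 ^+ k)%g.
Proof.
elim: k p q => [|k IH] p q pq; first by exists p, q; rewrite !expg0 mulg1 mul1g.
(* Once the first leaf of the fraction is expanded into a caret, [x0] written as a rotation composes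
   with it on either side. *)
have step : (x0 * fraction (Node Leaf p) (Node Leaf q)
    = fraction (Node Leaf (Node Leaf p)) (Node Leaf (Node Leaf q)) * x0)%g.
  rewrite -(@fraction_attach (Node Leaf Leaf :: nseq (leaves p) Leaf) (Node Leaf p)); last 2 first.
  - by rewrite /= pq.
  - by rewrite /= size_nseq.
  rewrite /= drop0 !attach_nseq // -{1}(fraction_rotate Leaf Leaf p).
  rewrite -(fraction_rotate Leaf Leaf q) !fraction_mul //= ?pq //; lia.
have [|p' [q' [pq' e]]] := IH (Node Leaf p) (Node Leaf q); first by rewrite /= pq.
by exists p', q'; rewrite expgSr -mulgA step mulgA e -mulgA.
Qed.

(** * Mixing and fixed vectors *)

Section HilbertSpace.
Variables (R : realType) (H : hilbertSpace R).
Local Notation C := R[i].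
Local Notation "''[' u , v ]" := (inner H u v) : ring_scope.

Lemma innerC (u v : H) : '[u, v] = Num.conj '[v, u].
Proof. by rewrite (hermC (inner H) u v) expr0 mul1r. Qed.

Lemma hnorm_sqr (v : H) : (hnorm v ^+ 2)%:C = '[v, v].
Proof.
have ge0 := dnorm_ge0 (inner H) v.
have e := RRe_real (ger0_real ge0).
by rewrite /hnorm /dot_norm sqr_sqrtr ?e // -lecR e.
Qed.

Lemma cauchy_schwarz (u v : H) : `|'[u, v]| <= (hnorm u * hnorm v)%:C.
Proof.
rewrite -(@ler_pXn2r _ 2) ?nnegrE //; last first.
  by rewrite lecR mulr_ge0 ?sqrtr_ge0.
have -> : (hnorm u * hnorm v)%:C ^+ 2 = '[u, u] * '[v, v].
  by rewrite -!hnorm_sqr !rmorphXn rmorphM exprMn.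
have [->|v0] := eqVneq v 0.
  by rewrite !linear0r normr0 expr0n.
have vv : '[v, v] != 0 by rewrite dnorm_eq0.
pose a := '[u, v] / '[v, v].
have uv0 : '[u - a *: v, v] = 0.
  by rewrite linearBl linearZl_LR /= divfK ?subrr.
have := dnorm_ge0 (inner H) (u - a *: v).
rewrite linearBr linearZr_LR /= uv0 mulr0 subr0 linearBl linearZl_LR /=.
rewrite subr_ge0 (innerC v u) /a mulrAC -normCK ler_pdivrMr //.
by rewrite dnorm_gt0.
Qed.

Lemma small_eq0 (a : C) (M : R) : 0 <= M ->
  (forall e : R, 0 < e -> `|a| <= (M * e)%:C) -> a = 0.
Proof.
move=> M0 h; apply/eqP; rewrite -normr_eq0.
move: h; rewrite normc_def; set r := Num.sqrt _ => h.
suff -> : r = 0 by [].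
apply/eqP; rewrite eq_le sqrtr_ge0 andbT leNgt; apply/negP => r0.
have M1 : 0 < M + 1 by lra.
(* [M] may be 0, hence the denominator [M + 1]. *)
have := h (r / (M + 1)) (divr_gt0 r0 M1); rewrite lecR mulrA ler_pdivlMr //.
by rewrite mulrDr mulr1 [r * M]mulrC; lra.
Qed.

Lemma span_orthogonal (S : set H) (z : H) :
  (forall s, S s -> '[z, s] = 0) -> forall v, span S v -> '[z, v] = 0.
Proof.
move=> zS v [n [a [u [Su ->]]]]; rewrite linear_sumr; apply: big1 => i _.
by rewrite linearZr_LR /= zS ?mulr0.
Qed.

Lemma closed_span_orthogonal (S : set H) (z : H) :
  (forall s, S s -> '[z, s] = 0) -> forall v, closed_span S v -> '[z, v] = 0.
Proof.
move=> zS v clv; apply: (small_eq0 (sqrtr_ge0 _ : 0 <= hnorm z)) => e e0.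
have [w Sw vw] := clv e e0.
rewrite -[v](subrK w) linearDr /= (span_orthogonal zS Sw) addr0.
apply: le_trans (cauchy_schwarz _ _) _.
by rewrite lecR ler_wpM2l ?sqrtr_ge0 // ltW.
Qed.

Lemma sub_closed_span (S : set H) : S `<=` closed_span S.
Proof.
move=> v Sv e e0; exists v; first exact: span_sub.
by rewrite subrr /hnorm /dot_norm linear0r /= sqrtr0.
Qed.

End HilbertSpace.

Section Mixing.
Variables (R : realType) (H : hilbertSpace R) (G : groupType).
Variables (rep : unitary_rep G H) (psi : H) (a : G).
Local Notation C := R[i].
Local Notation "''[' u , v ]" := (inner H u v) : ring_scope.
Hypothesis psi_unit : '[psi, psi] = 1.
Hypothesis mixing : forall g h : G, exists K, forall k, (K <= k)%N ->
  '[rep (h * a ^+ k * g)%g psi, psi] = '[rep h psi, psi] * '[rep g psi, psi].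

Lemma hnorm_unit (v : H) : '[v, v] = 1 -> hnorm v = 1.
Proof. by move=> v1; rewrite /hnorm /dot_norm v1 /= sqrtr1. Qed.

Lemma rho_hnorm g (v : H) : hnorm (rep g v) = hnorm v.
Proof. by rewrite /hnorm /dot_norm rho_inner. Qed.

Lemma rhoVl g (u v : H) : '[rep g u, v] = '[u, rep g^-1%g v].
Proof. by rewrite -(rho_inner rep g^-1%g (rep g u)) -rhoM mulVg rho1. Qed.

Definition orbit : set H := [set v | exists g : G, v = rep g psi].

Lemma mixing_span w h : span orbit w -> exists k,
  '[rep (a ^+ k)%g w, rep h psi] = '[w, psi] * '[psi, rep h psi].
Proof.
move=> [n [b [u [Ou ->]]]].
have /choice[K HK] i : exists K, forall k, (K <= k)%N ->
    '[rep (a ^+ k)%g (u i), rep h psi] = '[u i, psi] * '[psi, rep h psi].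
  (* Moving [rep h] to the left argument turns the coefficient into that of [h^-1 * a ^+ k * g]. *)
  have [g ->] := Ou i; have [K HK] := mixing g h^-1%g.
  exists K => k /HK; rewrite mulrC !rhoM => e.
  by rewrite -[h]invgK -!rhoVl e.
(* One exponent serves all of the finitely many terms. *)
exists (\max_i K i)%N; rewrite !(linear_sum, linear_sumlz) /=.
apply: eq_bigr => i _; rewrite linearZ !linearZl_LR /= HK //.
exact: leq_bigmax.
Qed.

(** Approximating [v] by [w] in the span and applying a large power of [a], which fixes [v], shows
    that [z] is orthogonal to the orbit, hence to [v] and [psi], hence to itself. *)
Lemma fixed_vector v : closed_span orbit v -> rep a v = v -> v = '[v, psi] *: psi.
Proof.
move=> clv av; pose z := v - '[v, psi] *: psi.
have avk k : rep (a ^+ k)%g v = v.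
  by elim: k => [|k IH]; rewrite ?expg0 ?rho1 // expgS rhoM IH.
have psi_orbit : orbit psi by exists 1%g; rewrite rho1.
have zorb s : orbit s -> '[z, s] = 0.
  (* Replacing [v] by [w] costs two errors of at most [e] each, hence the factor 2. *)
  move=> [h ->]; apply: (small_eq0 (M := 2)) => // e e0.
  have [w Ow vw] := clv e e0; have [k wk] := mixing_span h Ow.
  have -> : '[z, rep h psi] =
      '[rep (a ^+ k)%g (v - w), rep h psi] - '[v - w, psi] * '[psi, rep h psi].
    rewrite {1}/z linearB /= avk !linearBl /= wk linearZl_LR /=; ring.
  have h1 : hnorm (rep h psi) = 1 by rewrite rho_hnorm hnorm_unit.
  have bound (y x : H) : hnorm y = hnorm (v - w) -> hnorm x = 1 -> `|'[y, x]| <= e%:C.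
    move=> yv x1; apply: le_trans (cauchy_schwarz _ _) _.
    by rewrite x1 mulr1 yv lecR ltW.
  apply: le_trans (ler_normB _ _) _; rewrite mulrDl mul1r rmorphD; apply: lerD.
    by apply: bound => //; exact: rho_hnorm.
  rewrite normrM -[X in _ <= X]mulr1; apply: ler_pM => //.
    by apply: bound => //; exact: hnorm_unit.
  by apply: le_trans (cauchy_schwarz _ _) _; rewrite h1 hnorm_unit // mulr1.
have zpsi := zorb _ psi_orbit; have zv := closed_span_orthogonal zorb clv.
have zz : '[z, z] = 0 by rewrite {2}/z linearBr linearZr_LR /= zv zpsi mulr0 subr0.
by apply/eqP; rewrite -subr_eq0 -(dnorm_eq0 (inner H)); apply/eqP.
Qed.

End Mixing.

(** * Matrix coefficients of the vacuum *)

Section Coefficient.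
Variables (R : realType) (d : R) (L : limit_rep d).
Local Notation C := R[i].
Local Notation "''[' u , v ]" := (inner (lspace L) u v) : ring_scope.
Local Notation psi := (vacuum L).

Lemma gram_vec n (x y : diagram 0 n) :
  gram d (vec R x) (vec R y) = ev d (vec R (stack (mirror y) x)).
Proof. by rewrite /gram lstar_vec lcomp_vec. Qed.

Lemma inner_scale (a b : C) (u v : L) : '[a *: u, b *: v] = a * Num.conj b * '[u, v].
Proof. by rewrite linearZl_LR linearZr_LR /= mulrA. Qed.

(* If the empty diagram vanished, every closed diagram would have the same
   value, that of 0, and the vacuum would be 0. *)
Lemma empty_neq0 : ~ skein_eq d (vec R empty_diagram) 0.
Proof.
move=> e0.
have sc (a : C) : skein_eq d (a *: vec R empty_diagram) 0.
  by rewrite -[X in skein_eq d _ X](scaler0 _ a); exact: skeinZ.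
have ev0 (x : Lin R 0 0) : skein_eq d x 0 -> ev d x = ev d 0.
  move=> x0; rewrite /ev; congr (xget 0 _); apply/seteqP.
  by split=> b _ /=; apply: skein_trans (skein_sym (sc b)) => //; exact: skein_refl.
have gram0 : gram d (0 : Lin R 0 2) 0 = 0.
  by rewrite -(cls_inner L caret) linear0 linear0l.
have : gram d (vec R cup_diagram) (vec R cup_diagram) = 0.
  rewrite gram_vec ev0; first by rewrite -gram0 /gram lstar0 lcomp0.
  rewrite -closed_diagram_val; apply: skein_trans (evaluates_loop d) _.
  by rewrite closed_diagram_nil; exact: sc.
rewrite -(cls_inner L caret) => cup0.
have := vacuum_unit L; rewrite vacuumE linearZ /= inner_scale cup0 mulr0.
by move/eqP; rewrite eq_sym oner_eq0.
Qed.

(** The scalar chosen by [ev] is unique: two different ones would make the empty diagram vanish. *)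
Lemma ev_eq (D : diagram 0 0) (x : C) : evaluates d (val D) x -> ev d (vec R D) = x.
Proof.
rewrite /evaluates closed_diagram_val closed_diagram_nil => Dx; rewrite /ev.
have := xgetPex 0 (ex_intro (fun a => skein_eq d (vec R D) (a *: vec R empty_diagram)) x Dx).
set y := xget _ _ => /= Dy; apply/eqP; rewrite -subr_eq0; apply/negP => /negP yx.
apply: empty_neq0; rewrite -[vec R _]scale1r -(mulVf yx) -scalerA.
rewrite -[X in skein_eq d _ X](scaler0 _ (y - x)^-1); apply: skeinZ.
by rewrite /skein_eq subr0 scalerBl; exact: skein_trans (skein_sym Dy) Dx.
Qed.

Definition coefficient (g : thompsonF) : C := '[action L g psi, psi].

Hypothesis d0 : 0 < d.

Lemma node_forest n a b : leaves (Node a b) = n -> is_forest 2 n [:: a; b].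
Proof. by move=> <- /=; rewrite /is_forest /= addn0 !eqxx. Qed.

(** Both trees are grafted on the caret, so the vacuum has a representative at each; its two factors
    [d^(-1/2)] cancel the [d] of the hypothesis. *)
Lemma coefficient_pairing a b a' b' x :
  leaves (Node a' b') = leaves (Node a b) ->
  evaluates d (pairing_word a' b' a b) (x * d%:C) ->
  coefficient (fraction (Node a' b') (Node a b)) = x.
Proof.
move=> e ex; set n := leaves (Node a b) in e.
pose f : forest 2 n := 
    exist (fun h : seq tree => is_forest 2 n h) _ (node_forest (erefl n)).
pose f' : forest 2 n :=
    exist (fun h : seq tree => is_forest 2 n h) _ (node_forest e).
have psiE (h : forest 2 n) : psi = (Num.sqrt d)^-1%:C *:
    cls L (graft h caret) (vec R (stack (Phi h) cup_diagram)).
  by rewrite -lcomp_vec cls_graft vacuumE linearZ.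
have -> : fraction (Node a' b') (Node a b) = frac (graft f' caret) (graft f caret).
  by rewrite /frac -fractionE.
rewrite /coefficient {1}(psiE f) linearZ /= action_frac (psiE f') inner_scale.
rewrite cls_inner gram_vec (ev_eq (x := x * d%:C)).
  have sd0 : (Num.sqrt d)%:C != 0 :> C by rewrite fmorph_eq0 gt_eqF // sqrtr_gt0.
  have -> : Num.conj (Num.sqrt d)^-1%:C = (Num.sqrt d)^-1%:C :> C.
    exact: conjc_real.
  have -> : d%:C = (Num.sqrt d)%:C * (Num.sqrt d)%:C :> C.
    by rewrite -rmorphM -expr2 sqr_sqrtr // ltW.
  by rewrite fmorphV; field.
suff -> : val (stack (mirror (stack (Phi f') cup_diagram)) (stack (Phi f) cup_diagram))
    = pairing_word a' b' a b by [].
rewrite /= /pairing_word !cats0 !add0n /mirror_word /= rev_cons -cats1.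
by [].
Qed.

(** The two halves give separate bubbles, whose values multiply. *)
Lemma coefficient_product p q p' q' : leaves p = leaves q -> leaves p' = leaves q' ->
  coefficient (fraction (Node p' p) (Node q' q))
  = coefficient (fraction (Node p' Leaf) (Node q' Leaf))
    * coefficient (fraction (Node Leaf p) (Node Leaf q)).
Proof.
move=> pq pq'; have [x px] := bubble_valueP d pq; have [y py] := bubble_valueP d pq'.
have leaf := bubble_value_leaf d.
rewrite (@coefficient_pairing _ _ _ _ (x * y)); last 2 first.
- by rewrite /= pq pq'.
- by rewrite -mulrA; apply: evaluates_pairing.
rewrite (@coefficient_pairing q' Leaf p' Leaf y); last 2 first.
- by rewrite /= pq'.
- by rewrite -[_ * _]mul1r; apply: evaluates_pairing.
rewrite (@coefficient_pairing Leaf q Leaf p x); last 2 first.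
- by rewrite /= pq.
- by rewrite -[d%:C]mul1r; apply: evaluates_pairing.
exact: mulrC.
Qed.

(** Two unit vectors with inner product 1 are equal. *)
Lemma x0_vacuum : action L x0 psi = psi.
Proof.
have c1 : coefficient x0 = 1.
  by apply: coefficient_pairing => //; rewrite mul1r; exact: evaluates_theta.
apply/eqP; rewrite -subr_eq0 -(dnorm_eq0 (inner L)) linearBr !linearBl /=.
by rewrite rho_inner vacuum_unit (innerC psi) -/(coefficient x0) c1 rmorph1 !subrr.
Qed.

Lemma x0n_vacuum k : action L (x0 ^+ k)%g psi = psi.
Proof.
elim: k => [|k IH]; first by rewrite expg0 rho1.
by rewrite expgS rhoM IH x0_vacuum.
Qed.

Lemma coefficient_mulx0 k g : coefficient (g * x0 ^+ k)%g = coefficient g.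
Proof. by rewrite /coefficient rhoM x0n_vacuum. Qed.

Lemma coefficient_x0mul k g : coefficient (x0 ^+ k * g)%g = coefficient g.
Proof. by rewrite /coefficient rhoM -{2}(x0n_vacuum k) rho_inner. Qed.

Lemma coefficient_mixing g h : exists K, forall k, (K <= k)%N ->
  coefficient (h * x0 ^+ k * g)%g = coefficient h * coefficient g.
Proof.
have [i [j [p [q [pq eg]]]]] := right_form g.
have [i' [j' [p' [q' [pq' eh]]]]] := left_form h.
(* The power [i'] of [x0] is absorbed by [h] and [i] by [g]; the remaining [m] moves past the
   right-hand part of [g]. *)
exists (i' + i)%N => k ik; have [m ->] : exists m, k = (i' + m + i)%N.
  by exists (k - i' - i)%N; lia.
have [p2 [q2 [pq2 em]]] := x0_shift m pq.
rewrite !expgnDr; set X := (_ * _)%g.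
have -> : X = (x0 ^+ j' * (fraction (Node p' Leaf) (Node q' Leaf) *
    fraction (Node Leaf p2) (Node Leaf q2) * (x0 ^+ m * x0 ^+ j)))%g.
  by rewrite /X !mulgA eh -!mulgA eg [in LHS](mulgA (x0 ^+ m)%g) em !mulgA.
rewrite -fraction_node // -expgnDr coefficient_x0mul coefficient_mulx0.
rewrite coefficient_product //; congr (_ * _).
  by rewrite -(coefficient_x0mul j') -eh coefficient_mulx0.
by rewrite -(coefficient_mulx0 m) -em coefficient_x0mul -(coefficient_mulx0 j) -eg coefficient_x0mul.
Qed.

Lemma coefficient_tetrahedron :
  coefficient (fraction (Node Leaf (Node (Node Leaf Leaf) Leaf))
                        (Node (Node (Node Leaf Leaf) Leaf) Leaf))
  = ((d - 2) / (d - 1))%:C.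
Proof. by apply: coefficient_pairing => //; exact: evaluates_tetrahedron. Qed.

Lemma fixed_in_wysiwyg v : wysiwyg L v -> action L x0 v = v -> v = '[v, psi] *: psi.
Proof. exact: (fixed_vector (vacuum_unit L) coefficient_mixing). Qed.

Lemma orbit_wysiwyg g : wysiwyg L (action L g psi).
Proof. by apply: sub_closed_span; exists g. Qed.

Lemma vacuum_wysiwyg : wysiwyg L psi.
Proof. by rewrite -[psi](rho1 (action L)); exact: orbit_wysiwyg. Qed.

End Coefficient.

(** * Inequivalence of the representations *)

Lemma equivalent_coefficient (R : realType) (d d' : R) (L : limit_rep d) (L' : limit_rep d') :
  0 < d -> 0 < d' ->
  unitarily_equivalent (action L) (wysiwyg L) (action L') (wysiwyg L') ->
  coefficient L =1 coefficient L'.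
Proof.
move=> d0 d0' [U [[UK _] _ Uinner Uaction]] g.
have psiW := vacuum_wysiwyg L.
(* The image of the vacuum is fixed by [x0], hence a multiple of the other vacuum. *)
have := fixed_in_wysiwyg d0' (UK _ psiW).
rewrite -Uaction // x0_vacuum // => /(_ erefl); set a := inner _ _ _ => Upsi.
rewrite /coefficient -Uinner //; last exact: orbit_wysiwyg.
rewrite Uaction // Upsi [action L' g _]linearZ /= inner_scale.
(* Only the modulus of the factor enters the coefficient, and both vacua are unit vectors. *)
suff -> : a * Num.conj a = 1 by rewrite mul1r.
have := Uinner _ _ psiW psiW; rewrite vacuum_unit Upsi inner_scale vacuum_unit.
by rewrite mulr1.
Qed.

(** In the discrete case [d = 2 * cos (2 * pi / n) + 1], and [n >= 5] puts the angle below
    [pi / 2]. *)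
Lemma trivalent_parameters_gt1 (R : realType) (d : R) : trivalent_parameters d -> 1 < d.
Proof.
move=> [[n n5 ->]|]; last by lra.
have n0 : (0 : R) < n%:R by rewrite ltr0n; lia.
have : 0 < cos (pi / n%:R *+ 2 : R).
  have pn0 : 0 < pi / n%:R :> R by rewrite divr_gt0 // pi_gt0.
  apply: cos_gt0_pihalf; have -> : pi / n%:R *+ 2 = 2 / n%:R * pi :> R by field; lra.
  have := pi_gt0 R => pi0; apply/andP; split; first by nra.
  rewrite mulrC ltr_pM2l // ltr_pdivrMr //.
  have : (5 : R) <= n%:R by rewrite ler_nat.
  by lra.
by rewrite cos_mulr2n -mulr_natr; lra.
Qed.

Theorem corollary4p0p2 (R : realType) (d d' : R)
    (hd : trivalent_parameters d) (hd' : trivalent_parameters d')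
    (hdd' : d <> d') (L : limit_rep d) (L' : limit_rep d') :
  ~ unitarily_equivalent (action L) (wysiwyg L) (action L') (wysiwyg L').
Proof.
have d1 := trivalent_parameters_gt1 hd; have d1' := trivalent_parameters_gt1 hd'.
have d0 : 0 < d by lra.
have d0' : 0 < d' by lra.
move=> /(equivalent_coefficient d0 d0') e; apply: hdd'.
have := coefficient_tetrahedron L d0; rewrite e coefficient_tetrahedron //.
(* In this form the tetrahedron value is visibly injective in the parameter. *)
have div_eq (x : R) : 1 < x -> (x - 2) / (x - 1) = 1 - (x - 1)^-1.
  by move=> x1; field; lra.
move=> /complexI; rewrite !div_eq // => /addrI /oppr_inj /invr_inj.
by move/addIr.
Qed.
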